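(* For all $\delta\in(0,2/3)$ there exist $\eta>0$ and $C$ such that \[ \sum_{1\leq d\leq D}\ \max_{0\le y\leq x}\ \max_{j\in\mathbb Z} \left| A(y;d,j) - \frac{y}{2d} \right| \leq Cx^{1-\eta} \] for all real $x\geq 1$ and $D=x^\delta$. Here the sum is over integers $d$, and $y$ ranges over real numbers.
   Context: For a nonnegative integer $m$, $s(m)$ is the number of $1$s in the binary expansion of $m$. For real $y\geq 0$ and integers $d\geq 1$ and $j$, \[ A(y;d,j)=\left|\{0\le m<y:\ m\in\mathbb Z,\ s(m)\equiv 0\bmod 2,\ m\equiv j\bmod d\}\right|. \] The maxima are to be read as suprema. *)

(* Defs.v *)
From mathcomp Require Import all_boot all_order all_algebra.
From mathcomp Require Import all_classical all_reals all_analysis.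

Set Implicit Arguments.
Unset Strict Implicit.
Unset Printing Implicit Defensive.

Import Order.TTheory GRing.Theory Num.Theory.

Local Open Scope ring_scope.

(* Digits of index i >= m vanish because m < 2 ^ m. *)
Definition binary_ones (m : nat) : nat :=
  (\sum_(i < m) (m %/ 2 ^ i) %% 2)%N.

(* Every natural number m < y satisfies m <= Num.truncn y, so the ordinal type
   contains all of them; the strict real inequality m < y is part of the
   filter. *)
Definition A (R : realType) (y : R) (d : nat) (j : int) : nat :=
  #|[set m : 'I_(Num.truncn y).+1 |
      [&& (m%:R < y), (binary_ones m == 0 %[mod 2])%N
        & (m%:Z == j %[mod d%:Z])%Z]]|.

Definition discrepancy (R : realType) (y : R) (d : nat) (j : int) : R :=
  `|(A y d j)%:R - y / (2 * d%:R)|.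

(* The suprema are taken in the extended reals, where an unbounded set has
   supremum +oo (the real-valued sup would be 0). *)
Definition max_discrepancy (R : realType) (x : R) (d : nat) : \bar R :=
  ereal_sup [set ereal_sup [set (discrepancy y d j)%:E | j in [set: int]]
            | y in [set y : R | 0 <= y <= x]]%classic.

(* Main.v *)
Require Import Defs.
From mathcomp Require Import all_boot all_order all_algebra.
From mathcomp Require Import all_classical all_reals all_analysis.
From mathcomp Require Import zify ring lra.

(* Up to a bounded error per modulus, the discrepancy is half the absolute value
   of S = sum_(n < c) t (n d + j), where t m = (-1) ^ s(m). For d < D = 2 ^ k, cut
   S into blocks of N = D ^ (1/2 + epsilon) terms; as D < x ^ (2/3) there is room
   for this. A first van der Corput step replaces t by the sign of the lowest l
   digits, 2 ^ l being slightly larger than D; a second one, with shifts that are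
   multiples of 2 ^ m, slightly smaller than N, removes the lowest m digits. The
   remaining function of n d + j modulo 2 ^ l is constant on intervals of length
   about 2 ^ m, except for a few jumps, and for most d the points n d + j are
   equidistributed at this scale, uniformly in j: the second moment over all
   residues d modulo 2 ^ l of the number of hits can be computed and does not
   depend on j. The sum over a full period is a correlation
   sum_M u(M) u(M + a) u(M + b) u(M + a + b) of the Thue-Morse sign u of the
   v = l - m middle digits, and on average over d the shifts (a, b) cover all pairs
   modulo 2 ^ v up to a bounded multiplicity. The sum over all (a, b) of the
   absolute values saves a power of 2 ^ v, by a recursion on the lowest digit with
   finitely many carry states. Small moduli are reduced to large ones by splitting
   progressions, and dyadic ranges are added up. *)

Set Implicit Arguments.
Unset Strict Implicit.
Unset Printing Implicit Defensive.

Import Order.TTheory GRing.Theory Num.Theory.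

Local Open Scope ring_scope.

(** * Binary digit sums *)

(** Digits at positions where [2 ^ i] exceeds [m] vanish, so every sufficient width gives the same
    count. *)
Lemma binary_ones_widen m n : (m < 2 ^ n)%N ->
  binary_ones m = (\sum_(i < n) (m %/ 2 ^ i) %% 2)%N.
Proof.
have zero k l : (m < 2 ^ k)%N -> (k <= l)%N ->
    (\sum_(i < l) (m %/ 2 ^ i) %% 2 = \sum_(i < k) (m %/ 2 ^ i) %% 2)%N.
  move=> mk /subnKC <-; rewrite big_split_ord /= [X in (_ + X)%N]big1 ?addn0 // => i _.
  by rewrite divn_small // (leq_trans mk) // leq_exp2l // leq_addr.
move=> mn; rewrite /binary_ones.
have mm : (m < 2 ^ m)%N by apply: ltn_expl.
by case: (leqP m n) => [le|/ltnW le]; [rewrite (zero _ _ mm le)|rewrite (zero _ _ mn le)].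
Qed.

Lemma binary_ones_half m : binary_ones m = (odd m + binary_ones m./2)%N.
Proof.
have mm : (m < 2 ^ m.+1)%N by rewrite (ltn_trans (ltn_expl m (isT : 1 < 2)%N)) // ltn_exp2l.
have hm : (m./2 < 2 ^ m)%N.
  by apply: leq_ltn_trans (ltn_expl m (isT : 1 < 2)%N); lia.
rewrite (binary_ones_widen mm) (binary_ones_widen hm) big_ord_recl expn0 divn1 modn2.
congr (_ + _)%N; apply: eq_bigr => i _.
by rewrite /= /bump /= add1n expnS divnMA divn2.
Qed.

Section Sign.
Variable R : realFieldType.

Definition thue_morse (m : nat) : R := (-1) ^+ binary_ones m.

Lemma thue_morse_half m : thue_morse m = (-1) ^+ odd m * thue_morse m./2.
Proof. by rewrite /thue_morse binary_ones_half exprD. Qed.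

Lemma thue_morse_sqr m : thue_morse m * thue_morse m = 1.
Proof. by rewrite -expr2 sqrr_sign. Qed.

Lemma normr_thue_morse m : `|thue_morse m| = 1.
Proof. by rewrite normr_sign. Qed.

(** The digits of the two parts do not overlap: the expansion is a concatenation and the digit sums
    add. *)
Lemma thue_morse_split k a b : (b < 2 ^ k)%N ->
  thue_morse (2 ^ k * a + b) = thue_morse a * thue_morse b.
Proof.
elim: k a b => [|k IH] a b.
  rewrite expn0 ltnS leqn0 => /eqP ->; rewrite mul1n addn0.
  by rewrite {3}/thue_morse /binary_ones big_ord0 mulr1.
move=> bk; rewrite [LHS]thue_morse_half [thue_morse b]thue_morse_half.
have -> : odd (2 ^ k.+1 * a + b) = odd b by rewrite oddD oddM expnS oddM.
have -> : ((2 ^ k.+1 * a + b)./2 = 2 ^ k * a + b./2)%N.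
  by rewrite expnS -mulnA mul2n halfD odd_double /= add0n doubleK.
by rewrite IH 1?mulrCA //; move: bk; rewrite expnS; lia.
Qed.

(** The truncated Thue-Morse sign. Its period [2 ^ n] permits complete sums over residues. *)
Definition low_sign (n x : nat) : R := thue_morse (x %% 2 ^ n).

Lemma thue_morse_low k m :
  thue_morse m = thue_morse (m %/ 2 ^ k) * low_sign k m.
Proof.
rewrite -(@thue_morse_split k) ?ltn_mod ?expn_gt0 //.
by rewrite mulnC -divn_eq.
Qed.

Lemma low_signD k n x :
  low_sign (k + n) x = low_sign k x * low_sign n (x %/ 2 ^ k).
Proof.
rewrite {1}/low_sign (thue_morse_low k) mulrC; congr (_ * _).
  by rewrite /low_sign modn_dvdm // expnD dvdn_mulr.
by rewrite /low_sign modn_divl mulnC -expnD.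
Qed.

Lemma low_sign_sqr n x : low_sign n x * low_sign n x = 1.
Proof. exact: thue_morse_sqr. Qed.

Lemma normr_low_sign n x : `|low_sign n x| = 1.
Proof. exact: normr_thue_morse. Qed.

Lemma low_sign_congr n x y : (x = y %[mod 2 ^ n])%N ->
  low_sign n x = low_sign n y.
Proof. by rewrite /low_sign => ->. Qed.

Lemma low_signS n x : low_sign n.+1 x = (-1) ^+ odd x * low_sign n x./2.
Proof.
rewrite -add1n low_signD expn1 divn2 {1}/low_sign expn1 modn2 /thue_morse.
by case: (odd x); rewrite /binary_ones ?big_ord0 // big_ord1.
Qed.

End Sign.

(** * Correlations of the Thue-Morse sequence *)

Lemma big_ord_mul (V : nmodType) (f : nat -> V) a b :
  \sum_(i < a * b) f i = \sum_(i < a) \sum_(j < b) f (i * b + j)%N.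
Proof.
elim: a => [|a IH]; first by rewrite mul0n !big_ord0.
by rewrite mulSnr big_split_ord big_ord_recr /= IH.
Qed.

Lemma big_ord_split (V : nmodType) (f : nat -> V) a b : (a <= b)%N ->
  \sum_(i < b) f i = \sum_(i < a) f i + \sum_(i < b - a) f (a + i)%N.
Proof. by move=> /subnKC <-; rewrite big_split_ord /= addKn. Qed.

Lemma big_ord_pow2S (V : nmodType) (f : nat -> V) n :
  \sum_(i < 2 ^ n.+1) f i = \sum_(c <- [:: false; true]) \sum_(i < 2 ^ n) f (c + 2 * i)%N.
Proof.
rewrite expnSr big_ord_mul big_cons big_seq1 -big_split /=; apply: eq_bigr => i _.
by rewrite !big_ord_recl big_ord0 /= addr0 /bump /= !addn0 add0n mulnC addnC.
Qed.

Section Correlation.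
Variable R : realFieldType.
Local Notation u := (low_sign R).
Local Notation state := (nat * nat * nat)%type.

(* [e] holds the carries that reach the three shifted arguments from the digits
   already processed. *)
Definition corr n a b (e : state) : R :=
  \sum_(M < 2 ^ n)
    u n M * u n (M + a + e.1.1) * u n (M + b + e.1.2) * u n (M + a + b + e.2).

Definition carry (c al be : bool) (e : state) : state :=
  ((c + al + e.1.1)./2, (c + be + e.1.2)./2, (c + al + be + e.2)./2).

(** Put [M = c + 2 M']. In the sum of the four arguments [c] occurs four times and [al], [be] twice
    each, so only the carries affect the sign; halving each argument produces the new carries. *)
Lemma corrS n a b (al be : bool) e :
  corr n.+1 (al + 2 * a) (be + 2 * b) e =
  (-1) ^+ odd (e.1.1 + e.1.2 + e.2)
  * \sum_(c <- [:: false; true]) corr n a b (carry c al be e).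
Proof.
rewrite /corr (big_ord_pow2S (fun M => u n.+1 M * u n.+1 (M + (al + 2 * a) + e.1.1)
  * u n.+1 (M + (be + 2 * b) + e.1.2) * u n.+1 (M + (al + 2 * a) + (be + 2 * b) + e.2))).
rewrite big_distrr /=; apply: eq_bigr => c _.
rewrite big_distrr /=; apply: eq_bigr => M _.
rewrite !low_signS.
set x1 := (c + _)%N; set x2 := (x1 + _ + _)%N; set x3 := (x1 + _ + _)%N.
set x4 := (_ + e.2)%N.
have -> : x1./2 = M by rewrite /x1; lia.
have -> : x2./2 = (M + a + (c + al + e.1.1)./2)%N by rewrite /x2 /x1; lia.
have -> : x3./2 = (M + b + (c + be + e.1.2)./2)%N by rewrite /x3 /x1; lia.
have -> : x4./2 = (M + a + b + (c + al + be + e.2)./2)%N by rewrite /x4 /x1; lia.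
have -> : odd (e.1.1 + e.1.2 + e.2) = odd (x1 + x2 + x3 + x4).
  by rewrite /x4 /x3 /x2 /x1; lia.
rewrite !signr_odd !exprD; ring.
Qed.

(** A formal sum of carry states, [true] marking a minus sign. As a plain list it can be processed
    by computation. *)
Definition comb := seq (bool * state).

Definition eval n a b (c : comb) : R :=
  \sum_(s <- c) (-1) ^+ s.1 * corr n a b s.2.

Definition step al be (c : comb) : comb :=
  [seq (s.1 (+) odd (s.2.1.1 + s.2.1.2 + s.2.2), carry x al be s.2)
  | s <- c, x <- [:: false; true]].

Lemma evalS n a b (al be : bool) c :
  eval n.+1 (al + 2 * a) (be + 2 * b) c = eval n a b (step al be c).
Proof.
rewrite /eval /step big_allpairs_dep /=; apply: eq_bigr => s _.
by rewrite corrS mulrA -signr_addb big_distrr.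
Qed.

Definition corr_total n c : R :=
  \sum_(a < 2 ^ n) \sum_(b < 2 ^ n) `|eval n a b c|.

Lemma corr_totalS n c :
  corr_total n.+1 c = \sum_(al <- [:: false; true]) \sum_(be <- [:: false; true])
     corr_total n (step al be c).
Proof.
rewrite /corr_total (big_ord_pow2S (fun a => \sum_(b < 2 ^ n.+1) `|eval n.+1 a b c|)).
apply: eq_bigr => al _; rewrite [RHS]exchange_big /=; apply: eq_bigr => a _.
rewrite (big_ord_pow2S (fun b => `|eval n.+1 (al + 2 * a) b c|)).
by apply: eq_bigr => be _; apply: eq_bigr => b _; rewrite evalS.
Qed.

Definition valid (s : bool * state) :=
  [&& (s.2.1.1 <= 1)%N, (s.2.1.2 <= 1)%N & (s.2.2 <= 2)%N].

(** Three bits have half at most 1, and three bits plus 2 have half at most 2. Hence only finitely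
    many carry states occur. *)
Lemma valid_step al be c : all valid c -> all valid (step al be c).
Proof.
move=> /allP vc; apply/allP => s /allpairsP [[x y] /= [/vc + _ ->]].
rewrite /valid /carry /= => /and3P[]; case: x => ? [[a b] d] /=; lia.
Qed.

Definition cancels (c : comb) := has (fun s => (~~ s.1, s.2) \in c) c.

(** An upper bound for the number of terms that survive; cancelling a single opposite pair is enough
    for a saving. *)
Definition weight (c : comb) := if cancels c then (size c - 2)%N else size c.

Fixpoint word_weight k c :=
  if k is k'.+1 then
    (word_weight k' (step false false c) + word_weight k' (step false true c)
     + (word_weight k' (step true false c) + word_weight k' (step true true c)))%N
  else weight c.

Lemma corr_total_le_size n c (B : R) : all valid c ->
  (forall s, valid s -> corr_total n [:: s] <= B) -> corr_total n c <= B *+ size c.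
Proof.
move=> vc hB; elim: c vc => [_|s c IH /= /andP[vs vc]].
  by rewrite /corr_total big1 // => a _; rewrite big1 // => b _; rewrite /eval big_nil normr0.
rewrite mulrS; apply: le_trans (lerD (hB s vs) (IH vc)).
rewrite /corr_total -big_split ler_sum //= => a _; rewrite -big_split ler_sum //= => b _.
by rewrite /eval big_cons big_seq1 ler_normD.
Qed.

(** An opposite pair evaluates to zero and can be deleted from the list; the triangle inequality
    bounds the rest. *)
Lemma corr_total_le_weight n c (B : R) : all valid c ->
  (forall s, valid s -> corr_total n [:: s] <= B) -> corr_total n c <= B *+ weight c.
Proof.
move=> vc hB; rewrite /weight; case: ifP => [|_]; last exact: corr_total_le_size.
move=> /hasP[s sc nsc].
have nsc' : (~~ s.1, s.2) \in rem s c.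
  by rewrite (perm_mem (perm_to_rem sc)) inE in nsc; case/orP: nsc => // /eqP;
     case: (s) => [[] e] /=.
set c' := rem (~~ s.1, s.2) (rem s c).
have pc : perm_eq c [:: s, (~~ s.1, s.2) & c'].
  by rewrite (perm_trans (perm_to_rem sc)) // perm_cons perm_to_rem.
have -> : corr_total n c = corr_total n c'.
  apply: eq_bigr => a _; apply: eq_bigr => b _; congr `| _ |.
  rewrite /eval (perm_big _ pc) /= !big_cons /= addrA -mulrDl signrN addrN mul0r.
  by rewrite add0r.
have -> : (size c - 2 = size c')%N by rewrite (perm_size pc) /= subn2.
apply: corr_total_le_size => //.
by have := perm_all valid pc; rewrite vc /= => /esym /and3P[].
Qed.

Lemma corr_total_le_word_weight n k c (B : R) : all valid c ->
  (forall s, valid s -> corr_total n [:: s] <= B) ->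
  corr_total (k + n) c <= B *+ word_weight k c.
Proof.
move=> vc hB; elim: k c vc => [|k IH] c vc; first exact: corr_total_le_weight.
rewrite addSn corr_totalS !big_cons !big_nil !addr0 /= !mulrnDr.
by rewrite !lerD // IH // valid_step.
Qed.

(* The trivial bound is 512 = 8 ^ 3. Three digits are the least number for which
   every carry state meets a pair of opposite terms, which saves 2. *)
Lemma word_weight3 s : valid s -> (word_weight 3 [:: s] <= 510)%N.
Proof.
case: s => x [[a b] d] /and3P[/= ha hb hd].
move: a b d ha hb hd => [|[|]] // [|[|]] // [|[|[|]]] // _ _ _; case: x; by vm_compute.
Qed.

End Correlation.

Lemma bernoulli (R : realFieldType) (x : R) p : 0 <= x -> 1 + p%:R * x <= (1 + x) ^+ p.
Proof.
move=> x0; elim: p => [|p IH]; first by rewrite mul0r addr0.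
rewrite exprS; apply: le_trans (ler_wpM2l _ IH); last by rewrite addr_ge0.
rewrite -natr1; have : 0 <= p%:R * (x * x) by rewrite !mulr_ge0.
lra.
Qed.

(** The trivial bound is [8 ^ n]: there are [4 ^ n] pairs of shifts with [2 ^ n] terms each. Every
    three digits gain a factor 510 / 512, and [p] such gains amount to at least a factor 1 / 2,
    hence [Q = 3 p]. *)
Lemma corr_total_bound (R : realFieldType) : exists2 Q, (0 < Q)%N &
  forall n s, valid s -> corr_total R n [:: s] <= 8 ^+ n / 2 ^+ (n %/ Q).
Proof.
have [p p0 hp] : exists2 p, (0 < p)%N & 510 ^+ p * 2 <= (8 ^+ 3) ^+ p :> R.
  (* As [255 * (2 / 510) = 1], Bernoulli's inequality makes [(512 / 510) ^ 255] at least 2. *)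
  exists 255 => //; have -> : (8 : R) ^+ 3 = 510 * (1 + 2 / 510) by field.
  have c0 : (0 : R) < 510 by rewrite ltr0n.
  have x0 : (0 : R) <= 2 / 510 by apply: divr_ge0; rewrite ler0n.
  rewrite exprMn (ler_pM2l (exprn_gt0 _ c0)); apply: le_trans (bernoulli _ x0).
  lra.
exists (p * 3)%N => [|n]; first by rewrite muln_gt0 p0.
set Q := (p * 3)%N; have Q0 : (0 < Q)%N by rewrite muln_gt0 p0.
(* One digit at the trivial cost 8, for the remaining [n %% Q] digits. *)
have step1 m (B : R) : (forall s, valid s -> corr_total R m [:: s] <= B) ->
    forall s, valid s -> corr_total R m.+1 [:: s] <= 8 * B.
  move=> hB s vs; have vs1 : all valid [:: s] by rewrite /= vs.
  have B0 : 0 <= B.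
    by apply: le_trans (hB s vs); rewrite /corr_total sumr_ge0 // => a _; rewrite sumr_ge0.
  rewrite -[m.+1]/(1 + m)%N mulr_natl; apply: le_trans (corr_total_le_word_weight 1 vs1 hB) _.
  apply: ler_wpMn2l => //; rewrite /=.
  have w c : (weight c <= size c)%N by rewrite /weight; case: ifP; rewrite // leq_subr.
  by rewrite (leq_trans (leq_add (leq_add (w _) (w _)) (leq_add (w _) (w _)))).
have step3 m (B : R) : (forall s, valid s -> corr_total R m [:: s] <= B) ->
    forall s, valid s -> corr_total R (3 + m) [:: s] <= 510 * B.
  move=> hB s vs; have vs1 : all valid [:: s] by rewrite /= vs.
  have B0 : 0 <= B.
    by apply: le_trans (hB s vs); rewrite /corr_total sumr_ge0 // => a _; rewrite sumr_ge0.
  rewrite mulr_natl; apply: le_trans (corr_total_le_word_weight 3 vs1 hB) _.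
  by apply: ler_wpMn2l => //; apply: word_weight3.
have base s : valid s -> corr_total R 0 [:: s] <= 1.
  move=> _; rewrite /corr_total !big_ord_recl !big_ord0 !addr0 /eval big_seq1 /corr.
  by rewrite !big_ord_recl !big_ord0 !addr0 !normrM !normr_low_sign normr_sign !mulr1.
have low r s : valid s -> corr_total R r [:: s] <= 8 ^+ r.
  elim: r s => [|r IH] s; first by rewrite expr0; apply: base.
  by rewrite exprS; apply: step1.
have high i r s : valid s -> corr_total R (i * 3 + r) [:: s] <= 510 ^+ i * 8 ^+ r.
  elim: i s => [|i IH] s; first by rewrite mul0n expr0 mul1r; apply: low.
  by rewrite exprS -mulrA mulSn -addnA; apply: step3.
move=> s vs; rewrite {1}(divn_eq n Q) {1}/Q mulnA.
apply: le_trans (high _ _ _ vs) _.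
rewrite {3}(divn_eq n Q) exprD mulrAC ler_pM2r ?exprn_gt0 //.
rewrite -/Q; move: (n %/ Q)%N => q.
rewrite [(q * p)%N]mulnC [(q * Q)%N]mulnC (exprM _ p) (exprM _ Q) -expr_div_n.
rewrite /Q [(p * 3)%N]mulnC (exprM 8 3 p).
have x0 : 0 <= (510 : R) ^+ p by apply: exprn_ge0; rewrite ler0n.
have y0 : 0 <= ((8 : R) ^+ 3) ^+ p / 2 by rewrite divr_ge0 // !exprn_ge0.
by apply: lerXn2r; rewrite ?nnegrE // ler_pdivlMr.
Qed.

(** * Averages over dilations *)

(** With [h = h' 2 ^ v] and [h'] odd, divisibility forces [d] and [d'] to agree modulo
    [2 ^ (k - v)]. The quotient by that power takes [2 ^ v] values and then determines the
    element. *)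
Lemma card_dilation_fiber k h (S : {set 'I_(2 ^ k)}) : (0 < h)%N ->
  (forall d d', d \in S -> d' \in S -> (d' <= d)%N -> (2 ^ k %| h * (d - d'))%N) ->
  (#|S| <= 2 ^ logn 2 h)%N.
Proof.
move=> h0 hS; set v := logn 2 h.
have [kv|vk] := leqP k v.
  by rewrite (leq_trans (max_card _)) // card_ord leq_exp2l.
have [h' [odh hE]] : exists h', odd h' /\ (h = h' * 2 ^ v)%N.
  by have [h' odh hE] := pfactor_coprime (isT : prime 2) h0;
     exists h'; split; rewrite // -coprime2n.
have q0 : (0 < 2 ^ (k - v))%N by rewrite expn_gt0.
have ltq (d : 'I_(2 ^ k)) : (d %/ 2 ^ (k - v) < 2 ^ v)%N.
  by rewrite ltn_divLR // -expnD subnKC ?ltn_ord // ltnW.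
have inj : {in S &, injective (fun d : 'I_(2 ^ k) => Ordinal (ltq d))}.
  suff aux (d d' : 'I_(2 ^ k)) : d \in S -> d' \in S -> (d' <= d)%N ->
      (d %/ 2 ^ (k - v) = d' %/ 2 ^ (k - v))%N -> d = d'.
    move=> d d' dS d'S [] e; case: (leqP d' d) => [le|/ltnW le]; first exact: aux.
    by apply/esym/aux.
  move=> dS d'S le e; apply/val_inj => /=.
  have := hS d d' dS d'S le.
  have {1}-> : (2 ^ k = 2 ^ (k - v) * 2 ^ v)%N by rewrite -expnD subnK // ltnW.
  rewrite hE mulnAC dvdn_pmul2r ?expn_gt0 // Gauss_dvdr; last first.
    by rewrite coprimeXl // coprime2n.
  move=> dv; have : (d %% 2 ^ (k - v) == d' %% 2 ^ (k - v))%N by rewrite eqn_mod_dvd.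
  by move=> /eqP em; rewrite (divn_eq d (2 ^ (k - v))) e em -divn_eq.
by rewrite -(card_in_imset inj) (leq_trans (max_card _)) // card_ord.
Qed.

Section Dilation.
Variable R : realFieldType.

Lemma sum_dilation n h c (H : nat -> R) : (0 < h)%N ->
  (forall x, 0 <= H x) -> (forall x y, (x = y %[mod 2 ^ n])%N -> H x = H y) ->
  \sum_(d < 2 ^ n) H (h * d + c)%N <= 2 ^+ logn 2 h * \sum_(a < 2 ^ n) H a.
Proof.
move=> h0 H0 Hp.
have lt (d : 'I_(2 ^ n)) : ((h * d + c) %% 2 ^ n < 2 ^ n)%N by rewrite ltn_mod expn_gt0.
rewrite (partition_big (fun d => Ordinal (lt d)) predT) //= mulr_sumr.
apply: ler_sum => a _.
rewrite (eq_bigr (fun=> H a)); last first.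
  by move=> d /eqP <- /=; apply: Hp; rewrite modn_mod.
rewrite sumr_const -[X in X <= _]mulr_natl ler_wpM2r // -natrX ler_nat.
set P := (X in #|X|); rewrite -(cardsE P).
apply: card_dilation_fiber => // d d'; rewrite !inE => /eqP e.
move=> /eqP e' le; move: e e' => /= e e'; rewrite mulnBr.
by rewrite -(eqn_mod_dvd _ (leq_mul _ le)) // -(eqn_modDr c) e e'.
Qed.

Lemma corr_congr n a a' b b' : (a = a' %[mod 2 ^ n])%N -> (b = b' %[mod 2 ^ n])%N ->
  corr R n a b (0, 0, 0)%N = corr R n a' b' (0, 0, 0)%N.
Proof.
move=> ea eb; apply: eq_bigr => M _; rewrite !addn0.
congr (_ * _ * _ * _); apply: low_sign_congr.
- by rewrite -modnDmr ea modnDmr.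
- by rewrite -modnDmr eb modnDmr.
- by apply/eqP; rewrite -!addnA eqn_modDl -modnDm ea eb modnDm.
Qed.

(** Write [d = d1 2 ^ m + d0]. For fixed [d0] the second shift is constant modulo [2 ^ n], as
    [n <= m], while [d1] moves the first shift through a dilation by [h]. The sum over [d0] then
    consists of [2 ^ (m - n)] periods of a dilation by [h']. *)
Lemma sum_corr_dilation n m p h h' (al : nat -> nat) (a : nat -> nat) : (n <= m)%N ->
  (0 < h < 2 ^ p)%N -> (0 < h' < 2 ^ p)%N ->
  (forall d0 d1, (a (d1 * 2 ^ m + d0) = h * d1 + al d0)%N) ->
  \sum_(d < 2 ^ (n + m)) `|corr R n (a d) (h' * d) (0, 0, 0)%N|
    <= 2 ^+ p * 2 ^+ p * 2 ^+ (m - n) * corr_total R n [:: (false, (0, 0, 0)%N)].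
Proof.
move=> nm /andP[h0 hp] /andP[h'0 h'p] ha.
have log_le q : (0 < q < 2 ^ p)%N -> (2 : R) ^+ logn 2 q <= 2 ^+ p.
  move=> /andP[q0 qp]; rewrite -!natrX ler_nat (leq_trans _ (ltnW qp)) //.
  by rewrite dvdn_leq // pfactor_dvdnn.
pose H2 b := \sum_(a < 2 ^ n) `|corr R n a b (0, 0, 0)%N|.
have H20 b : 0 <= H2 b by apply: sumr_ge0.
have H2p x y : (x = y %[mod 2 ^ n])%N -> H2 x = H2 y.
  by move=> e; apply: eq_bigr => i _; rewrite (corr_congr (erefl _) e).
rewrite expnD (big_ord_mul (fun d => `|corr R n (a d) (h' * d)%N (0, 0, 0)%N|)) exchange_big /=.
have -> : corr_total R n [:: (false, (0, 0, 0)%N)] = \sum_(b < 2 ^ n) H2 b.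
  rewrite /corr_total exchange_big; apply: eq_bigr => b _; apply: eq_bigr => a' _.
  by rewrite /eval big_seq1 expr0 mul1r.
apply: (@le_trans _ _ (2 ^+ p * \sum_(d0 < 2 ^ m) H2 (h' * d0)%N)).
  rewrite mulr_sumr; apply: ler_sum => d0 _.
  have lp := log_le h; rewrite h0 hp in lp.
  apply: le_trans (ler_wpM2r (H20 _) (lp isT)).
  rewrite (eq_bigr (fun d1 : 'I__ => `|corr R n (h * d1 + al d0) (h' * d0) (0, 0, 0)%N|)).
    apply: (sum_dilation (al d0) (H := fun a => `|corr R n a (h' * d0) (0, 0, 0)%N|)) => //.
    by move=> x y e; rewrite (corr_congr e (erefl _)).
  move=> d1 _; rewrite ha; congr `| _ |; apply: corr_congr => //.
  move: (nat_of_ord d1) (nat_of_ord d0) => x y.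
  by rewrite mulnDr -(subnK nm) expnD !mulnA modnMDl.
rewrite -!mulrA ler_wpM2l ?exprn_ge0 //.
have -> : \sum_(d < 2 ^ m) H2 (h' * d)%N =
    \sum_(i < 2 ^ (m - n)) \sum_(j < 2 ^ n) H2 (h' * (i * 2 ^ n + j))%N.
  by rewrite -(big_ord_mul (fun d => H2 (h' * d)%N)) -expnD subnK.
rewrite (eq_bigr (fun=> \sum_(j < 2 ^ n) H2 (h' * j + 0)%N)); last first.
  by move=> i _; apply: eq_bigr => j _; apply: H2p; rewrite addn0 mulnDr mulnA modnMDl.
rewrite sumr_const card_ord -[X in X <= _]mulr_natl natrX mulrCA ler_wpM2l ?exprn_ge0 //.
have lp := log_le h'; rewrite h'0 h'p in lp.
apply: le_trans (ler_wpM2r _ (lp isT)); first exact: sum_dilation.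
exact: sumr_ge0.
Qed.

End Dilation.

(** * Equidistribution of most progressions modulo a power of 2 *)

Lemma sum_ord_sqr_le (R : realFieldType) n (a : nat -> R) :
  (\sum_(i < n) a i) ^+ 2 <= n%:R * \sum_(i < n) a i ^+ 2.
Proof.
elim: n => [|n IH]; first by rewrite !big_ord0 expr0n mulr0.
rewrite !big_ord_recr /= -natr1.
move: IH; set S := \sum_(i < n) a i; set Q := \sum_(i < n) _; set x := a n => IH.
have Q0 : 0 <= Q by apply: sumr_ge0 => i _; rewrite sqr_ge0.
have [n0|n0] := posnP n.
  have -> : S = 0 by rewrite /S n0 big_ord0.
  by rewrite n0 mulr0n !add0r mul1r lerDr.
have n0' : 0 < n%:R :> R by rewrite ltr0n.
have : 2 * S * x <= Q + n%:R * x ^+ 2.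
  have : 0 <= (S - n%:R * x) ^+ 2 by rewrite sqr_ge0.
  move=> h; rewrite -(ler_pM2l n0'); apply: le_trans (_ : S ^+ 2 + (n%:R * x) ^+ 2 <= _); lra.
lra.
Qed.

Lemma leq_sum_ord_widen m n (f : nat -> nat) : (m <= n)%N ->
  (\sum_(i < m) f i <= \sum_(i < n) f i)%N.
Proof. by move=> /subnKC <-; rewrite big_split_ord /= leq_addr. Qed.

Lemma sum_congr_le T q t : (0 < q)%N ->
  (\sum_(t' < T) (t' == t %[mod q]) <= T %/ q + 1)%N.
Proof.
move=> q0; have le : (T <= (T %/ q + 1) * q)%N.
  by rewrite {1}(divn_eq T q) addn1 mulSnr leq_add2l ltnW // ltn_mod.
apply: leq_trans (leq_sum_ord_widen (fun t' => (t' == t %[mod q])%N) le) _.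
rewrite (big_ord_mul (fun t' => (t' == t %[mod q])%N : nat)).
have lt : (t %% q < q)%N by rewrite ltn_mod.
rewrite (eq_bigr (fun=> 1%N)) ?sum_nat_const ?card_ord ?muln1 // => i _.
rewrite (bigD1 (Ordinal lt)) //= modnMDl modn_mod eqxx big1 // => j jt.
rewrite modnMDl (modn_small (ltn_ord j)); case: eqP => // e.
by case/eqP: jt; apply: val_inj.
Qed.

(** The second moment of the hit counts. An offset [j] common to all points would cancel from the
    congruence, which makes the resulting bounds uniform in [j]. *)
Definition collisions l N T d :=
  (\sum_(n < N) \sum_(t < T) \sum_(n' < N) \sum_(t' < T)
    (n' * d + t' == n * d + t %[mod 2 ^ l]))%N.

(** A collision says that [(n - n') d] is congruent to [t' - t]. With [2 ^ v] the power of 2 in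
    [n - n'], this requires [2 ^ v] to divide [t' - t] and then leaves at most [2 ^ v] values of
    [d]; for each [t] at most [T / 2 ^ v + 1] values [t'] qualify. *)
Lemma sum_collisions_off_diag l T n n' : (n' < n < 2 ^ l)%N ->
  (\sum_(d < 2 ^ l) \sum_(t < T) \sum_(t' < T) (n' * d + t' == n * d + t %[mod 2 ^ l])
    <= T * (T + 2 ^ logn 2 (n - n')))%N.
Proof.
move=> /andP[n'n nl]; set v := logn 2 (n - n').
have h0 : (0 < n - n')%N by rewrite subn_gt0.
have vh : (2 ^ v %| n - n')%N by rewrite pfactor_dvdnn.
have vl : (v <= l)%N.
  rewrite -(@leq_exp2l 2) // (leq_trans (dvdn_leq h0 vh)) //.
  by rewrite (leq_trans (leq_subr _ _)) // ltnW.
have one t t' : (\sum_(d < 2 ^ l) (n' * d + t' == n * d + t %[mod 2 ^ l])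
    <= 2 ^ v * (t' == t %[mod 2 ^ v]))%N.
  have [e|ne] := boolP (t' == t %[mod 2 ^ v])%N.
    rewrite muln1 -big_mkcond sum1_card.
    set P := (X in #|X|); rewrite -(cardsE P); apply: card_dilation_fiber => // d d'.
    rewrite !inE => /eqP e1 /eqP e2 le.
    suff : (n' * d + t' + (n * d' + t) == n' * d' + t' + (n * d + t) %[mod 2 ^ l])%N.
      have X : (n' * d' + t' + (n * d + t)
          = n' * d + t' + (n * d' + t) + (n - n') * (d - d'))%N.
        have aux a b x y : (x * y + t' + ((x + a) * (y + b) + t)
            = x * (y + b) + t' + ((x + a) * y + t) + a * b)%N by ring.
        by have := aux (n - n')%N (d - d')%N n' (d' : nat); rewrite !subnKC // ltnW.
      by rewrite X eq_sym eqn_mod_dvd ?leq_addr // addKn.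
    by rewrite -modnDm e1 -e2 modnDm addnC.
  rewrite muln0 big1 // => d _; apply/eqP; rewrite eqb0; apply: contra ne => /eqP e.
  have dl : (2 ^ v %| 2 ^ l)%N by rewrite dvdn_exp2l.
  have : (n' * d + t' = n * d + t %[mod 2 ^ v])%N.
    by rewrite -(modn_dvdm (n' * d + t') dl) e modn_dvdm.
  have -> : (n * d + t = (n - n') * d + (n' * d + t))%N.
    by rewrite addnA -mulnDl subnK // ltnW.
  by rewrite -[X in _ = X]modnDml (eqP (dvdn_mulr d vh)) add0n => /eqP; rewrite eqn_modDl.
rewrite exchange_big /=.
apply: (@leq_trans (\sum_(t < T) \sum_(t' < T) 2 ^ v * (t' == t %[mod 2 ^ v]))).
  by apply: leq_sum => t _; rewrite exchange_big; apply: leq_sum => t' _; apply: one.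
apply: (@leq_trans (\sum_(t < T) (T + 2 ^ v))%N); last by rewrite sum_nat_const card_ord.
apply: leq_sum => t _; rewrite -big_distrr /=.
apply: leq_trans (leq_mul (leqnn _) (sum_congr_le T t _)) _; first by rewrite expn_gt0.
by rewrite mulnDr muln1 leq_add2r mulnC leq_trunc_div.
Qed.

(** On the diagonal [T <= 2 ^ l] leaves only [t' = t]. Off it, the power of 2 in the difference of
    [n] and [n'] is one term of the sum over [a], a form that is easily summed over [n']. *)
Lemma sum_collisions_pair l p T n n' : (p <= l)%N -> (T <= 2 ^ l)%N ->
  (n < 2 ^ p)%N -> (n' < 2 ^ p)%N ->
  (\sum_(d < 2 ^ l) \sum_(t < T) \sum_(t' < T) (n' * d + t' == n * d + t %[mod 2 ^ l])
    <= (n' == n) * (2 ^ l * T)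
       + T * (T + \sum_(a < p) 2 ^ a * (n' == n %[mod 2 ^ a])))%N.
Proof.
move=> pl Tl np n'p.
have le2 : (2 ^ p <= 2 ^ l)%N by rewrite leq_exp2l.
have aux m m' : (m' < m < 2 ^ p)%N ->
    (2 ^ logn 2 (m - m') <= \sum_(a < p) 2 ^ a * (m == m' %[mod 2 ^ a]))%N.
  move=> /andP[m'm mp]; have h0 : (0 < m - m')%N by rewrite subn_gt0.
  have vp : (logn 2 (m - m') < p)%N.
    rewrite -(@ltn_exp2l 2) // (leq_ltn_trans (dvdn_leq h0 (pfactor_dvdnn _ _))) //.
    by rewrite (leq_ltn_trans (leq_subr _ _)).
  rewrite (bigD1 (Ordinal vp)) //= eqn_mod_dvd ?(ltnW m'm) // pfactor_dvdnn /= muln1.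
  by rewrite leq_addr.
case: (ltngtP n' n) => [lt|lt|->] /=; last first.
- rewrite mul1n (leq_trans _ (leq_addr _ _)) //.
  rewrite (eq_bigr (fun=> T)) ?sum_nat_const ?card_ord // => d _.
  transitivity (\sum_(t < T) 1)%N; last by rewrite sum_nat_const card_ord muln1.
  apply: eq_bigr => t _.
  rewrite (bigD1 t) //= eqxx big1 // => t' tt'; rewrite eqn_modDl !modn_small.
  - by case: eqP => // /val_inj e; rewrite e eqxx in tt'.
  - by rewrite (leq_trans (ltn_ord t)).
  - by rewrite (leq_trans (ltn_ord t')).
- rewrite mul0n add0n.
  under eq_bigr do rewrite exchange_big /=.
  under eq_bigr do under eq_bigr do under eq_bigr do rewrite eq_sym.
  have nn : (n < n' < 2 ^ l)%N by rewrite lt (leq_trans n'p).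
  apply: leq_trans (sum_collisions_off_diag T nn) _.
  by rewrite leq_mul2l leq_add2l aux ?orbT // lt.
- rewrite mul0n add0n.
  have nn : (n' < n < 2 ^ l)%N by rewrite lt (leq_trans np).
  apply: leq_trans (sum_collisions_off_diag T nn) _.
  under [X in (_ <= _ * (_ + X))%N]eq_bigr do rewrite eq_sym.
  by rewrite leq_mul2l leq_add2l aux ?orbT // lt.
Qed.

(** The first term is the value for perfect equidistribution, the second the diagonal. In the third,
    every [a < p] contributes [2 ^ p + 2 ^ a <= 2 * 2 ^ p] for each [n], up to the factor [T]. *)
Lemma sum_collisions l p T : (p <= l)%N -> (T <= 2 ^ l)%N ->
  (\sum_(d < 2 ^ l) collisions l (2 ^ p) T d
    <= (2 ^ p * T) ^ 2 + 2 ^ p * T * 2 ^ l + 2 * p * T * (2 ^ p) ^ 2)%N.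
Proof.
move=> pl Tl; rewrite /collisions exchange_big /=.
have -> : (\sum_(n < 2 ^ p) \sum_(d < 2 ^ l) \sum_(t < T) \sum_(n' < 2 ^ p) \sum_(t' < T)
    (n' * d + t' == n * d + t %[mod 2 ^ l])
  = \sum_(n < 2 ^ p) \sum_(n' < 2 ^ p) \sum_(d < 2 ^ l) \sum_(t < T) \sum_(t' < T)
    (n' * d + t' == n * d + t %[mod 2 ^ l]))%N.
  apply: eq_bigr => n _; rewrite [RHS]exchange_big; apply: eq_bigr => d _.
  by rewrite exchange_big.
apply: (@leq_trans (\sum_(n < 2 ^ p) (2 ^ l * T + T * (2 ^ p * T + 2 * p * 2 ^ p)))%N); last first.
  by rewrite sum_nat_const card_ord; apply/eq_leq; ring.
apply: leq_sum => n _.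
apply: leq_trans.
  by apply: leq_sum => n' _; apply: (sum_collisions_pair pl Tl (ltn_ord n) (ltn_ord n')).
rewrite big_split /= leq_add //.
  rewrite (bigD1 n) //= eqxx mul1n big1 ?addn0 // => i ni.
  by rewrite (inj_eq val_inj) (negbTE ni).
rewrite -big_distrr leq_mul2l big_split /= sum_nat_const card_ord leq_add2l exchange_big /=.
apply/orP; right; apply: (@leq_trans (\sum_(a < p) 2 * 2 ^ p)%N); last first.
  by rewrite sum_nat_const card_ord; apply/eq_leq; ring.
apply: leq_sum => a _.
rewrite -big_distrr /=.
apply: leq_trans (leq_mul (leqnn _) (sum_congr_le _ n _)) _; first by rewrite expn_gt0.
rewrite mulnDr muln1 mulnC mul2n -addnn leq_add ?leq_trunc_div //.
by rewrite leq_exp2l // ltnW.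
Qed.

(** * Deviation of the hit counts from their mean *)

Section Deviation.
Variable R : realFieldType.

Definition hits l N T d j m :=
  (\sum_(n < N) \sum_(t < T) ((n * d + j + t) %% 2 ^ l == m))%N.

Lemma sum_hits l N T d j (g : nat -> R) :
  (forall x, g (x %% 2 ^ l)%N = g x) ->
  \sum_(n < N) \sum_(t < T) g (n * d + j + t)%N
    = \sum_(m < 2 ^ l) g m * (hits l N T d j m)%:R.
Proof.
move=> gp; under [RHS]eq_bigr do rewrite natr_sum mulr_sumr.
rewrite [RHS]exchange_big; apply: eq_bigr => n _ /=.
under [RHS]eq_bigr do rewrite natr_sum mulr_sumr.
rewrite [RHS]exchange_big; apply: eq_bigr => t _ /=.
have lt : ((n * d + j + t) %% 2 ^ l < 2 ^ l)%N by rewrite ltn_mod expn_gt0.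
rewrite (bigD1 (Ordinal lt)) //= eqxx mulr1 big1 ?addr0 ?gp // => m ne.
case: eqP => [e|_]; last by rewrite mulr0.
by case/eqP: ne; apply: val_inj.
Qed.

Definition deviation l N T d j : R :=
  \sum_(m < 2 ^ l) `|(hits l N T d j m)%:R - (N * T)%:R / 2 ^+ l|.

(** Grouping the points by residue turns the left side into a sum of [g] weighted by hit counts;
    replacing every count by its mean costs [deviation]. *)
Lemma equidistribution l N T d j (g : nat -> R) :
  (forall x, g (x %% 2 ^ l)%N = g x) -> (forall x, `|g x| <= 1) ->
  `|\sum_(n < N) \sum_(t < T) g (n * d + j + t)%N|
    <= (N * T)%:R / 2 ^+ l * `|\sum_(m < 2 ^ l) g m| + deviation l N T d j.
Proof.
move=> gp g1; rewrite (sum_hits _ _ _ _ gp).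
set c := _ / _; have c0 : 0 <= c by rewrite divr_ge0 ?exprn_ge0.
rewrite -{1}(ger0_norm c0) -normrM mulr_sumr.
rewrite (eq_bigr (fun m : 'I__ => c * g m + g m * ((hits l N T d j m)%:R - c))); last first.
  by move=> m _; ring.
rewrite big_split /=; apply: le_trans (ler_normD _ _) _; rewrite lerD2l.
apply: le_trans (ler_norm_sum _ _ _) _; apply: ler_sum => m _.
by rewrite normrM ler_piMl.
Qed.

Lemma sum_hits_sqr l N T d j :
  \sum_(m < 2 ^ l) (hits l N T d j m)%:R ^+ 2 = (collisions l N T d)%:R :> R.
Proof.
pose g x : R := (hits l N T d j (x %% 2 ^ l)%N)%:R.
have := sum_hits N T d j (g := g) (fun x => congr1 (fun y => (hits l N T d j y)%:R) (modn_mod _ _)).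
rewrite [X in _ = X -> _](eq_bigr (fun m : 'I__ => (hits l N T d j m)%:R ^+ 2)); last first.
  by move=> m _; rewrite /g modn_small.
move=> <-; rewrite /collisions natr_sum; apply: eq_bigr => n _.
rewrite natr_sum; apply: eq_bigr => t _; rewrite /g /hits; congr (_%:R).
apply: eq_bigr => n' _; apply: eq_bigr => t' _; congr (nat_of_bool _).
by rewrite ![(_ + j)%N]addnC -!addnA eqn_modDl.
Qed.

Lemma deviation_ge0 l N T d j : 0 <= deviation l N T d j.
Proof. exact: sumr_ge0. Qed.

(** Cauchy-Schwarz over the residues, followed by the variance identity: the hit counts have sum
    [N T] and square sum [collisions]. *)
Lemma deviation_sqr_le l N T d j :
  deviation l N T d j ^+ 2 <= 2 ^+ l * (collisions l N T d)%:R - (N * T)%:R ^+ 2.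
Proof.
apply: le_trans (sum_ord_sqr_le _ (fun m => `|(hits l N T d j m)%:R - (N * T)%:R / 2 ^+ l|)) _.
set c := _ / _; set H := fun m => (hits l N T d j m)%:R : R.
have -> : \sum_(m < 2 ^ l) `|(hits l N T d j m)%:R - c| ^+ 2
    = (collisions l N T d)%:R - 2 * c * \sum_(m < 2 ^ l) H m + (2 ^ l)%:R * c ^+ 2.
  rewrite -(sum_hits_sqr l N T d j) mulr_sumr -sumrB.
  have -> : (2 ^ l)%:R * c ^+ 2 = \sum_(m < 2 ^ l) c ^+ 2.
    by rewrite sumr_const card_ord mulr_natl.
  rewrite -big_split /=; apply: eq_bigr => m _.
  by rewrite real_normK ?num_real // /H; ring.
have -> : \sum_(m < 2 ^ l) H m = (N * T)%:R.
  have := sum_hits N T d j (g := fun=> 1) (fun x : nat => erefl : (1 : R) = 1).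
  move/(_ l); rewrite (eq_bigr (fun=> T%:R)); last first.
    by move=> n _; rewrite sumr_const card_ord.
  rewrite sumr_const card_ord -[X in X = _ -> _]mulr_natl -natrM => ->.
  by apply: eq_bigr => m _; rewrite mul1r.
rewrite natrX /c; rewrite le_eqVlt; apply/orP; left; apply/eqP; field; rewrite ?lt0r_neq0 ?exprn_gt0 //.
Qed.

(** The main terms cancel exactly. The offset may vary with [d], so that the worst offset can be
    taken for every modulus. *)
Lemma sum_deviation_sqr l p T (j : nat -> nat) : (p <= l)%N -> (T <= 2 ^ l)%N ->
  \sum_(d < 2 ^ l) deviation l (2 ^ p) T d (j d) ^+ 2
    <= 2 ^+ l * T%:R * 2 ^+ p * (2 ^+ l + 2 * p%:R * 2 ^+ p).
Proof.
move=> pl Tl; apply: le_trans.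
  by apply: ler_sum => d _; apply: (deviation_sqr_le l (2 ^ p) T d (j d)).
rewrite sumrB -mulr_sumr -natr_sum sumr_const card_ord -[X in _ - X]mulr_natl natrX.
rewrite -mulrBr -!mulrA ler_wpM2l ?exprn_ge0 // lerBlDl.
have := sum_collisions pl Tl; rewrite -(ler_nat R) => /le_trans -> //.
by rewrite !natrD !natrM !natrX; rewrite le_eqVlt; apply/orP; left; apply/eqP; ring.
Qed.

End Deviation.

(** * The van der Corput inequality *)

Section VanDerCorput.
Variable R : realFieldType.
Implicit Types (a g : nat -> R) (N H K l m T d j c : nat).

Lemma sum_ord_shift_le a N c : (forall n, `|a n| <= 1) ->
  `|\sum_(n < N) a n - \sum_(n < N) a (n + c)%N| <= 2 * c%:R.
Proof.
move=> a1; elim: c => [|c IH].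
  by under [X in _ - X]eq_bigr do rewrite addn0; rewrite subrr normr0 mulr0.
rewrite -(natr1 c) mulrDr; set S := \sum_(n < N) _; set S1 := \sum_(n < N) _.
have -> : S - S1 = (S - \sum_(n < N) a (n + c)%N) + (\sum_(n < N) a (n + c)%N - S1) by ring.
apply: le_trans (ler_normD _ _) _; apply: lerD => //.
have -> : \sum_(n < N) a (n + c)%N - S1 = a c - a (N + c)%N.
  have := @big_ord_recl R 0 +%R N (fun n : 'I_N.+1 => a (n + c)%N).
  rewrite big_ord_recr /= => e.
  rewrite -[X in X - _](addrK (a (N + c)%N)) e add0n /S1.
  rewrite (eq_bigr (fun n : 'I__ => a (n + c.+1)%N)) => [|i _]; first by ring.
  by rewrite /bump /= add1n addSnnS.
by apply: le_trans (ler_normB _ _) _; rewrite mulr1; apply: (lerD (a1 c) (a1 _)).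
Qed.

(** [S] is compared with its average over the shifts [h K], [h < H], and Cauchy-Schwarz is applied
    in [n]. Shifted sums may leave the range; this costs [2 h K] each and produces the last term. *)
Lemma van_der_corput a N H K : (forall n, `|a n| <= 1) ->
  (H%:R * \sum_(n < N) a n) ^+ 2
  <= 2 * N%:R * (\sum_(h < H) \sum_(h' < H) \sum_(n < N) a (n + h * K)%N * a (n + h' * K)%N)
     + 8 * H%:R ^+ 4 * K%:R ^+ 2.
Proof.
move=> a1; set S := \sum_(n < N) a n.
pose X := \sum_(n < N) \sum_(h < H) a (n + h * K)%N.
have SX : `|H%:R * S - X| <= 2 * H%:R ^+ 2 * K%:R.
  have -> : H%:R * S - X = \sum_(h < H) (S - \sum_(n < N) a (n + h * K)%N).
    by rewrite sumrB /X exchange_big sumr_const card_ord mulr_natl.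
  apply: le_trans (ler_norm_sum _ _ _) _.
  apply: (@le_trans _ _ (\sum_(h < H) 2 * H%:R * K%:R)); last first.
    by rewrite sumr_const card_ord -[X in X <= _]mulr_natl; lra.
  apply: ler_sum => h _; apply: le_trans (sum_ord_shift_le _ _ a1) _.
  rewrite -mulrA ler_wpM2l // -natrM ler_nat leq_mul2r ltnW ?orbT //.
have X2 : X ^+ 2 <= N%:R * (\sum_(h < H) \sum_(h' < H) \sum_(n < N)
     a (n + h * K)%N * a (n + h' * K)%N).
  apply: le_trans (sum_ord_sqr_le _ (fun n => \sum_(h < H) a (n + h * K)%N)) _.
  rewrite ler_wpM2l // le_eqVlt; apply/orP; left; apply/eqP.
  under [RHS]eq_bigr do rewrite exchange_big /=.
  rewrite [RHS]exchange_big /=; apply: eq_bigr => n _.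
  by rewrite expr2 big_distrlr.
have : (H%:R * S) ^+ 2 <= 2 * X ^+ 2 + 2 * (H%:R * S - X) ^+ 2.
  have : 0 <= (H%:R * S - X - X) ^+ 2 by apply: sqr_ge0.
  by lra.
have : (H%:R * S - X) ^+ 2 <= (2 * H%:R ^+ 2 * K%:R) ^+ 2.
  by rewrite -real_normK ?num_real // lerXn2r // nnegrE ?normr_ge0 // !mulr_ge0 ?exprn_ge0.
rewrite !exprMn; set A := X ^+ 2; set B := (_ - X) ^+ 2; set C := \sum_(h < H) _.
by move: X2; rewrite -/A -/C; lra.
Qed.

Lemma sum_periodic_shift g c l : (forall x, g (x %% 2 ^ l)%N = g x) ->
  \sum_(x < 2 ^ l) g (x + c)%N = \sum_(x < 2 ^ l) g x.
Proof.
move=> gp; elim: c => [|c IH].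
  by apply: eq_bigr => x _; rewrite addn0.
rewrite -IH; have := @big_ord_recl R 0 +%R (2 ^ l) (fun n : 'I_(2 ^ l).+1 => g (n + c)%N).
rewrite big_ord_recr /= add0n -(gp (2 ^ l + c)%N) modnDl gp addrC => /addrI ->.
by apply: eq_bigr => x _; rewrite /bump /= add1n addSnnS.
Qed.

Lemma sum_modn_lt m w : \sum_(x < 2 ^ m) ((x %% 2 ^ m < w)%N)%:R <= w%:R :> R.
Proof.
rewrite -natr_sum ler_nat; under eq_bigr do rewrite modn_small //.
have [le|/ltnW le] := leqP w (2 ^ m).
  rewrite -(subnKC le) big_split_ord /= [X in (_ + X)%N]big1 ?addn0 => [|i _].
    by rewrite (eq_bigr (fun=> 1%N)) ?sum1_card ?card_ord // => i _; rewrite ltn_ord.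
  by rewrite ltnNge leq_addr.
apply: leq_trans le; rewrite -[X in (_ <= X)%N]card_ord -sum1_card.
by apply: leq_sum => i _; apply: leq_b1.
Qed.

(** A bad [x] sends all [T] points [x + t + c] into a window of [w] residues modulo [2 ^ m], and
    equidistribution limits the visits to that window. *)
Lemma sum_bad_le l m N T d j c w (bad : nat -> bool) : (m <= l)%N ->
  (forall x t, bad x -> (t < T)%N -> ((x + t + c) %% 2 ^ m < w)%N) ->
  T%:R * \sum_(n < N) (bad (n * d + j)%N)%:R
    <= (N * T)%:R / 2 ^+ m * w%:R + deviation R l N T d j.
Proof.
move=> ml hb; pose g x : R := (((x + c) %% 2 ^ m < w)%N)%:R.
have dvd : (2 ^ m %| 2 ^ l)%N by rewrite dvdn_exp2l.
have gp x : g (x %% 2 ^ l)%N = g x.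
  by rewrite /g -modnDml modn_dvdm // modnDml.
have g1 x : `|g x| <= 1 by rewrite normr_nat lern1 leq_b1.
have := equidistribution N T d j gp g1.
have -> : `|\sum_(m0 < 2 ^ l) g m0| = \sum_(m0 < 2 ^ l) g m0.
  by rewrite ger0_norm // sumr_ge0.
have -> : `|\sum_(n < N) \sum_(t < T) g (n * d + j + t)%N|
    = \sum_(n < N) \sum_(t < T) g (n * d + j + t)%N.
  by rewrite ger0_norm // sumr_ge0 // => n _; rewrite sumr_ge0.
have G : \sum_(x < 2 ^ l) g x <= 2 ^+ (l - m) * w%:R.
  pose g0 x : R := ((x %% 2 ^ m < w)%N)%:R.
  rewrite (sum_periodic_shift c (g := g0)) => [|x]; last by rewrite /g0 modn_dvdm.
  have -> : \sum_(x < 2 ^ l) g0 x = \sum_(i < 2 ^ (l - m)) \sum_(x < 2 ^ m) g0 (i * 2 ^ m + x)%N.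
    by rewrite -(big_ord_mul g0) -expnD subnK.
  apply: (@le_trans _ _ (\sum_(i < 2 ^ (l - m)) w%:R)); last first.
    by rewrite sumr_const card_ord -[X in X <= _]mulr_natl natrX.
  apply: ler_sum => i _; apply: le_trans (sum_modn_lt m w); apply: ler_sum => x _.
  by rewrite /g0 modnMDl.
move=> le; rewrite mulr_sumr; apply: le_trans (_ : _ <= \sum_(n < N) \sum_(t < T) g (n * d + j + t)%N) _.
  apply: ler_sum => n _; case: (boolP (bad _)) => [b|_]; last by rewrite mulr0 sumr_ge0.
  rewrite mulr1 (eq_bigr (fun=> 1)) ?sumr_const ?card_ord // => t _.
  by rewrite /g hb.
apply: le_trans le _; rewrite lerD2r.
have -> : (2 : R) ^+ l = 2 ^+ (l - m) * 2 ^+ m by rewrite -exprD subnK.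
apply: le_trans (ler_wpM2l _ G) _; first by rewrite divr_ge0 // mulr_ge0 ?exprn_ge0.
rewrite le_eqVlt; apply/orP; left; apply/eqP; field.
by rewrite !lt0r_neq0 ?exprn_gt0.
Qed.

End VanDerCorput.

(** * The average over the moduli below a power of 2 *)

Lemma divn_add_small q y z t : (0 < q)%N -> ((y + z) %% q + t < q)%N ->
  ((y + t + z) %/ q = (y + z) %/ q)%N.
Proof.
move=> q0 h; rewrite addnAC {1}(divn_eq (y + z) q) -addnA divnMDl //.
by rewrite [((_ + t) %/ _)%N]divn_small ?addn0.
Qed.

(** A point within distance [T] of the end of its block is moved past the end by a further shift of
    [T], hence into the first [2 T] residues. *)
Lemma modn_wrap_small q y z T t : (q < (y + z) %% q + T)%N -> (t < T)%N ->
  (0 < q)%N -> ((y + t + (z + T)) %% q < 2 * T)%N.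
Proof.
move=> h tT q0.
have -> : (y + t + (z + T) = (y + z) + (t + T))%N by lia.
rewrite -modnDml.
have lt : ((y + z) %% q < q)%N by rewrite ltn_mod.
have -> : ((y + z) %% q + (t + T) = 1 * q + ((y + z) %% q + T - q + t))%N by lia.
by rewrite modnMDl (leq_ltn_trans (leq_mod _ _)) //; lia.
Qed.

(** * The fourfold products left by two van der Corput steps *)

Section Box.
Variable R : realFieldType.
Local Notation u := (low_sign R).
Implicit Types (N k l m p v T d j r s t x : nat).

(* What two van der Corput steps leave of the sign at [x = n * d + j]: the digits
   of index >= v + m were discarded beforehand, and those of index < m cancel
   because the second shifts [s * 2 ^ m * d], [s' * 2 ^ m * d] do not touch them. *)
Definition box v m d r r' s s' x : R :=
  u v ((x + r * d) %/ 2 ^ m + s * d) * u v ((x + r * d) %/ 2 ^ m + s' * d)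
  * u v ((x + r' * d) %/ 2 ^ m + s * d) * u v ((x + r' * d) %/ 2 ^ m + s' * d).

Lemma normr_box v m d r r' s s' x : `|box v m d r r' s s' x| = 1.
Proof. by rewrite !normrM !normr_low_sign !mulr1. Qed.

Lemma box_symr v m d r r' s s' x : box v m d r r' s s' x = box v m d r' r s s' x.
Proof. by rewrite /box; ring. Qed.

Lemma box_syms v m d r r' s s' x : box v m d r r' s s' x = box v m d r r' s' s x.
Proof. by rewrite /box; ring. Qed.

Lemma box_mod v m d r r' s s' x :
  box v m d r r' s s' (x %% 2 ^ (v + m))%N = box v m d r r' s s' x.
Proof.
have e i k : ((x %% 2 ^ (v + m) + i) %/ 2 ^ m + k = (x + i) %/ 2 ^ m + k %[mod 2 ^ v])%N.
  rewrite [in RHS](divn_eq x (2 ^ (v + m))) expnD mulnA -addnA divnMDl ?expn_gt0 //.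
  by rewrite -addnA modnMDl.
by rewrite /box; congr (_ * _ * _ * _); apply: low_sign_congr.
Qed.

(** With [x = M 2 ^ m + y], the sum over [M] is complete modulo [2 ^ v], and a translation turns it
    into a correlation. Its shifts are the difference of the two quotients and [(s' - s) d]. *)
Lemma sum_box v m d r r' s s' : (r <= r')%N -> (s <= s')%N ->
  `|\sum_(x < 2 ^ (v + m)) box v m d r r' s s' x|
  <= \sum_(y < 2 ^ m)
      `|corr R v ((y + r' * d) %/ 2 ^ m - (y + r * d) %/ 2 ^ m) ((s' - s) * d) (0, 0, 0)%N|.
Proof.
move=> rr ss; rewrite expnD (big_ord_mul (box v m d r r' s s')) exchange_big /=.
apply: le_trans (ler_norm_sum _ _ _) _; apply: ler_sum => y _.
rewrite le_eqVlt; apply/orP; left; apply/eqP; congr `| _ |.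
set a := ((y + r * d) %/ 2 ^ m)%N; set a' := ((y + r' * d) %/ 2 ^ m)%N.
have aa : (a <= a')%N by rewrite leq_div2r // leq_add2l leq_mul2r rr orbT.
pose g M : R := u v M * u v (M + (a' - a)) * u v (M + (s' - s) * d)
   * u v (M + (a' - a) + (s' - s) * d).
have gp x : g (x %% 2 ^ v)%N = g x.
  rewrite /g; congr (_ * _ * _ * _); apply: low_sign_congr.
  - by rewrite modn_mod.
  - by rewrite modnDml.
  - by rewrite modnDml.
  - by rewrite -!addnA modnDml.
rewrite [RHS](_ : _ = \sum_(M < 2 ^ v) g M); last first.
  by apply: eq_bigr => M _; rewrite !addn0.
rewrite -(sum_periodic_shift (a + s * d) gp); apply: eq_bigr => M _.
have sd : (s * d + (s' - s) * d = s' * d)%N by rewrite -mulnDl subnKC.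
rewrite /box /g.
have e b : ((M * 2 ^ m + y + b) %/ 2 ^ m = M + (y + b) %/ 2 ^ m)%N.
  by rewrite -addnA divnMDl // expn_gt0.
rewrite !e -/a -/a'.
have -> : (M + (a + s * d) + (a' - a) = M + a' + s * d)%N by lia.
have -> : (M + (a + s * d) + (s' - s) * d = M + a + s' * d)%N by lia.
have -> : (M + a' + s * d + (s' - s) * d = M + a' + s' * d)%N by lia.
have -> : (M + (a + s * d) = M + a + s * d)%N by lia.
ring.
Qed.

(** By symmetry [r < r'] and [s < s']. For fixed [y] the first shift grows by [(r' - r) d1] when
    [d1 2 ^ m] is added to [d0], as [sum_corr_dilation] requires. *)
Lemma sum_sum_box v m p r r' s s' : (v <= m)%N ->
  (r < 2 ^ p)%N -> (r' < 2 ^ p)%N -> (s < 2 ^ p)%N -> (s' < 2 ^ p)%N ->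
  r != r' -> s != s' ->
  \sum_(d < 2 ^ (v + m)) `|\sum_(x < 2 ^ (v + m)) box v m d r r' s s' x|
  <= 2 ^+ m * (2 ^+ p * 2 ^+ p * 2 ^+ (m - v) * corr_total R v [:: (false, (0, 0, 0)%N)]).
Proof.
move=> vm; wlog lr : r r' / (r < r')%N.
  move=> W hr hr' hs hs' nr ns; move: (nr); rewrite neq_ltn => /orP[lr|lr]; first exact: W.
  under eq_bigr do under eq_bigr do rewrite box_symr.
  by apply: W => //; rewrite eq_sym.
wlog ls : s s' / (s < s')%N.
  move=> W hr hr' hs hs' nr ns; move: (ns); rewrite neq_ltn => /orP[ls|ls]; first exact: W.
  under eq_bigr do under eq_bigr do rewrite box_syms.
  by apply: W => //; rewrite eq_sym.
move=> hr hr' hs hs' _ _.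
apply: le_trans.
  by apply: ler_sum => d _; apply: (sum_box v m d (ltnW lr) (ltnW ls)).
rewrite exchange_big /=.
apply: (@le_trans _ _ (\sum_(y < 2 ^ m)
   (2 ^+ p * 2 ^+ p * 2 ^+ (m - v) * corr_total R v [:: (false, (0, 0, 0)%N)]))); last first.
  by rewrite sumr_const card_ord -[X in X <= _]mulr_natl natrX.
apply: ler_sum => y _.
apply: (@sum_corr_dilation R v m p (r' - r) (s' - s)
   (fun d0 => (y + r' * d0) %/ 2 ^ m - (y + r * d0) %/ 2 ^ m)%N
   (fun d => (y + r' * d) %/ 2 ^ m - (y + r * d) %/ 2 ^ m)%N) => //.
- by rewrite subn_gt0 lr (leq_ltn_trans (leq_subr _ _)).
- by rewrite subn_gt0 ls (leq_ltn_trans (leq_subr _ _)).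
move=> d0 d1.
have e b : ((y + b * (d1 * 2 ^ m + d0)) %/ 2 ^ m = b * d1 + (y + b * d0) %/ 2 ^ m)%N.
  by rewrite mulnDr mulnA addnCA divnMDl // expn_gt0.
rewrite !e mulnBl.
have h1 : (r * d1 <= r' * d1)%N by rewrite leq_mul2r (ltnW lr) orbT.
have h2 : ((y + r * d0) %/ 2 ^ m <= (y + r' * d0) %/ 2 ^ m)%N.
  by rewrite leq_div2r // leq_add2l leq_mul2r (ltnW lr) orbT.
lia.
Qed.

(** [box] is constant along [T] consecutive arguments unless [x + r d] or [x + r' d] crosses a
    multiple of [2 ^ m]. Each of these two exceptional sets enters with a factor 2, whence
    [5 = 1 + 2 * 2] and [8 = 2 * (2 + 2)]. *)
Lemma sum_box_le_deviation v m N T d j r r' s s' :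
  T%:R * `|\sum_(n < N) box v m d r r' s s' (n * d + j)%N|
  <= (N * T)%:R / 2 ^+ (v + m) * `|\sum_(x < 2 ^ (v + m)) box v m d r r' s s' x|
     + 5 * deviation R (v + m) N T d j + 8 * ((N * T)%:R / 2 ^+ m * T%:R).
Proof.
set l := (v + m)%N; set f := box v m d r r' s s'.
pose bad r x := (2 ^ m < (x + r * d) %% 2 ^ m + T)%N.
have q0 : (0 < 2 ^ m)%N by rewrite expn_gt0.
have ml : (m <= l)%N by apply: leq_addl.
have hbad r0 : T%:R * \sum_(n < N) (bad r0 (n * d + j)%N)%:R
    <= (N * T)%:R / 2 ^+ m * (2 * T)%:R + deviation R l N T d j.
  apply: (@sum_bad_le R l m N T d j (r0 * d + T) (2 * T) (bad r0)) => // x t b tT.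
  exact: modn_wrap_small.
have near x t : (t < T)%N -> `|f x - f (x + t)%N| <= 2 * ((bad r x)%:R + (bad r' x)%:R).
  move=> tT.
  have two : `|f x - f (x + t)%N| <= 2.
    by apply: le_trans (ler_normB _ _) _; rewrite /f !normr_box; lra.
  have [b|nb] := boolP (bad r x).
    by apply: le_trans two _; have : 0 <= (bad r' x)%:R :> R by []; rewrite /=; lra.
  have [b'|nb'] := boolP (bad r' x); first by apply: le_trans two _; rewrite /=; lra.
  have room i : ~~ bad i x -> ((x + i * d) %% 2 ^ m + t < 2 ^ m)%N.
    by rewrite /bad -leqNgt => h; apply: leq_trans h; rewrite ltn_add2l.
  rewrite /f /box (divn_add_small q0 (room r nb)) (divn_add_small q0 (room r' nb')).
  by rewrite subrr normr0 mulr_ge0 ?addr_ge0.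
have := equidistribution N T d j (@box_mod v m d r r' s s')
  (fun x => eq_ind_r (fun y => y <= 1) (lexx 1) (normr_box v m d r r' s s' x)).
rewrite -/l -/f => main.
have diff : `|T%:R * \sum_(n < N) f (n * d + j)%N - \sum_(n < N) \sum_(t < T) f (n * d + j + t)%N|
   <= 2 * (T%:R * \sum_(n < N) (bad r (n * d + j)%N)%:R
           + T%:R * \sum_(n < N) (bad r' (n * d + j)%N)%:R).
  rewrite -mulrDr -big_split /= mulrCA !mulr_sumr -sumrB.
  apply: le_trans (ler_norm_sum _ _ _) _; apply: ler_sum => n _.
  have -> : T%:R * f (n * d + j)%N = \sum_(t < T) f (n * d + j)%N.
    by rewrite sumr_const card_ord mulr_natl.
  rewrite -sumrB; apply: le_trans (ler_norm_sum _ _ _) _.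
  apply: (@le_trans _ _ (\sum_(t < T) 2 * ((bad r (n * d + j)%N)%:R + (bad r' (n * d + j)%N)%:R))).
    by apply: ler_sum => t _; apply: near.
  by rewrite sumr_const card_ord -[X in X <= _]mulr_natl.
have T0 : 0 <= T%:R :> R by [].
rewrite -{1}(ger0_norm T0) -normrM.
have := hbad r; have := hbad r'.
move: main diff; rewrite [(2 * T)%:R]natrM.
set A := T%:R * \sum_(n < N) f _; set B := \sum_(n < N) \sum_(t < T) _.
set D := deviation _ _ _ _ _ _; set E := (N * T)%:R / 2 ^+ m.
move=> main diff h1 h2; have : `|A| <= `|A - B| + `|B|.
  by apply: le_trans (ler_normD _ _); rewrite subrK.
lra.
Qed.

End Box.

(** * From the fourfold products back to Thue-Morse sums *)

Section ModulusAverage.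
Variable R : realFieldType.
Implicit Types (p q v : nat) (j : nat -> nat).
Local Notation t := (thue_morse R).

Lemma ler_sum_ord_widen a b (f : nat -> R) : (a <= b)%N -> (forall i, 0 <= f i) ->
  \sum_(i < a) f i <= \sum_(i < b) f i.
Proof. by move=> /subnKC <- f0; rewrite big_split_ord /= lerDl sumr_ge0. Qed.

Lemma expr2D2 q p : (2 : R) ^+ (q + 2 * p) = 2 ^+ q * 2 ^+ p ^+ 2.
Proof. by rewrite exprD mulnC exprM. Qed.

Lemma expr2D4 q p : (2 : R) ^+ (q + 4 * p) = 2 ^+ q * 2 ^+ p ^+ 4.
Proof. by rewrite exprD mulnC exprM. Qed.

(* The moduli are below [2 ^ (v + q)], the sums have [2 ^ (q + 4 * p)] terms, each
   van der Corput step uses [2 ^ p] shifts, the digits of index in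
   [q + 2 * p, v + q + 2 * p) survive, and points are smoothed over [2 ^ q]
   consecutive residues. Sums of length about the square root of the modulus are
   reached since [v] may be almost as large as [q]. *)
Definition admissible p q v :=
  [/\ (v + 2 * p <= q)%N, (2 * p <= v)%N, ((q + 4 * p) * 2 ^ (4 * p) <= 2 ^ q)%N
    & corr_total R v [:: (false, (0, 0, 0)%N)] <= 8 ^+ v / 2 ^+ (5 * p)].

(** Cauchy-Schwarz over [d] reduces this to the second moment, which is extended to all residues [d]
    modulo [2 ^ l]. *)
Lemma sum_deviation_le p q v j : admissible p q v ->
  \sum_(d < 2 ^ (v + q)) deviation R (v + (q + 2 * p)) (2 ^ (q + 4 * p)) (2 ^ q) d (j d)
  <= 2 * (2 ^+ (v + q) * 2 ^+ (q + 4 * p) * 2 ^+ q / 2 ^+ p).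
Proof.
move=> [h1 h2 h3 _]; set l := (v + (q + 2 * p))%N; set n := (q + 4 * p)%N.
pose dev d := deviation R l (2 ^ n) (2 ^ q) d (j d).
have nl : (n <= l)%N by rewrite /n /l; lia.
have ql : (2 ^ q <= 2 ^ l)%N by rewrite leq_exp2l // /l; lia.
have step : (\sum_(d < 2 ^ (v + q)) dev d) ^+ 2
   <= 2 ^+ (v + q) * (2 ^+ l * (2 ^ q)%:R * 2 ^+ n * (2 ^+ l + 2 * n%:R * 2 ^+ n)).
  apply: le_trans (sum_ord_sqr_le _ dev) _; rewrite natrX ler_wpM2l ?exprn_ge0 //.
  apply: le_trans (sum_deviation_sqr R j nl ql).
  apply: (@ler_sum_ord_widen _ _ (fun d => dev d ^+ 2)) => [|d]; last exact: sqr_ge0.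
  by rewrite leq_exp2l // /l; lia.
have E : (2 : R) ^+ l = 2 ^+ v * 2 ^+ q * 2 ^+ p ^+ 2 by rewrite /l exprD expr2D2 mulrA.
have En : (2 : R) ^+ n = 2 ^+ q * 2 ^+ p ^+ 4 by rewrite /n expr2D4.
have H1 : (2 : R) ^+ v * 2 ^+ p ^+ 2 <= 2 ^+ q.
  by rewrite -exprM mulnC -exprD -!natrX ler_nat leq_exp2l.
have H3 : n%:R * 2 ^+ p ^+ 4 <= 2 ^+ q :> R.
  by rewrite -exprM mulnC -!natrX -natrM ler_nat.
have P0 : 0 < (2 : R) ^+ p by rewrite exprn_gt0.
have Q0 : 0 < (2 : R) ^+ q by rewrite exprn_gt0.
have V0 : 0 < (2 : R) ^+ v by rewrite exprn_gt0.
rewrite -(@ler_pXn2r _ 2) // ?nnegrE; last 2 first.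
- by apply: sumr_ge0 => d _; apply: deviation_ge0.
- by rewrite !mulr_ge0 ?invr_ge0 ?exprn_ge0.
apply: le_trans step _; rewrite natrX E En exprD.
move: H1 H3 P0 Q0 V0; set P := 2 ^+ p; set Q := 2 ^+ q; set V := 2 ^+ v; set x := n%:R.
move=> H1 H3 P0 Q0 V0.
have -> : (2 * (V * Q * (Q * P ^+ 4) * Q / P)) ^+ 2 = 4 * (V ^+ 2 * Q ^+ 5 * P ^+ 6) * Q.
  by field; rewrite lt0r_neq0.
have -> : V * Q * (V * Q * P ^+ 2 * Q * (Q * P ^+ 4) * (V * Q * P ^+ 2 + 2 * x * (Q * P ^+ 4)))
   = (V ^+ 2 * Q ^+ 5 * P ^+ 6) * (V * P ^+ 2 + 2 * (x * P ^+ 4)) by ring.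
(* [H1] and [H3], from the first and third conditions of [admissible], bound the last bracket by
   [3 Q]. *)
rewrite [4 * _]mulrC -[X in _ <= X]mulrA ler_pM2l ?mulr_gt0 ?exprn_gt0 //; lra.
Qed.

(** The constant 19 collects 1 from the complete sums, 10 from the deviations and 8 from the
    crossings of multiples of [2 ^ m]. *)
Lemma sum_box_terms_le p q v j r r' s s' : admissible p q v ->
  (r < 2 ^ p)%N -> (r' < 2 ^ p)%N -> (s < 2 ^ p)%N -> (s' < 2 ^ p)%N ->
  r != r' -> s != s' ->
  \sum_(d < 2 ^ (v + q))
     `|\sum_(n < 2 ^ (q + 4 * p)) box R v (q + 2 * p) d r r' s s' (n * d + j d)%N|
  <= 19 * (2 ^+ (v + q) * 2 ^+ (q + 4 * p) / 2 ^+ p).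
Proof.
move=> adm hr hr' hs hs' nr ns; have D := sum_deviation_le j adm.
case: adm => [h1 h2 h3 hc]; set m := (q + 2 * p)%N in D *; set N := (q + 4 * p)%N in D *.
have vm : (v <= m)%N by rewrite /m; lia.
have B := sum_sum_box R vm hr hr' hs hs' nr ns.
have {}B : \sum_(d < 2 ^ (v + q)) `|\sum_(x < 2 ^ (v + m)) box R v m d r r' s s' x|
    <= 2 ^+ m * (2 ^+ p * 2 ^+ p * 2 ^+ (m - v) * (8 ^+ v / 2 ^+ (5 * p))).
  apply: le_trans (_ : _ <= \sum_(d < 2 ^ (v + m)) `|\sum_(x < 2 ^ (v + m)) box R v m d r r' s s' x|) _.
    apply: (@ler_sum_ord_widen _ _ (fun d => `|\sum_(x < 2 ^ (v + m)) box R v m d r r' s s' x|)) => //.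
    by rewrite leq_exp2l // /m; lia.
  apply: le_trans B _; rewrite !ler_wpM2l // ?mulr_ge0 ?exprn_ge0 //.
have S := ler_sum (index_enum _) (P := xpredT) (fun (d : 'I_(2 ^ (v + q))) _ =>
  sum_box_le_deviation R v m (2 ^ N) (2 ^ q) d (j d) r r' s s').
rewrite -mulr_sumr !big_split /= -!mulr_sumr sumr_const card_ord in S.
move: S; rewrite -[(2 ^ q)%:R *+ _]mulr_natl.
have E8 : (8 : R) ^+ v = 2 ^+ v ^+ 3.
  by rewrite -exprM mulnC exprM; congr (_ ^+ _); ring.
have Em : (2 : R) ^+ (m - v) = 2 ^+ m / 2 ^+ v.
  by rewrite -[in RHS](subnK vm) exprD mulfK // lt0r_neq0 ?exprn_gt0.
move: B D; rewrite Em E8 natrM !natrX [(5 * p)%N]mulnC [2 ^+ (v + m)]exprD.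
rewrite ![2 ^+ (v + q)]exprD !exprM.
have -> : (2 : R) ^+ m = 2 ^+ q * 2 ^+ p ^+ 2 by rewrite /m expr2D2.
have -> : (2 : R) ^+ N = 2 ^+ q * 2 ^+ p ^+ 4 by rewrite /N expr2D4.
have P0 : 1 <= (2 : R) ^+ p by rewrite exprn_ege1 // ler1n.
have Q0 : 0 < (2 : R) ^+ q by rewrite exprn_gt0.
have V0 : 0 < (2 : R) ^+ v by rewrite exprn_gt0.
move: P0 Q0 V0; set P := 2 ^+ p; set Q := 2 ^+ q; set V := 2 ^+ v.
set X := \sum_(d < _) _; set Y := \sum_(d < _) _; set Z := \sum_(d < _) _.
move=> P1 Q0 V0; have P0 : 0 < P by apply: lt_le_trans P1.
have P0' := lt0r_neq0 P0; have Q0' := lt0r_neq0 Q0; have V0' := lt0r_neq0 V0.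
move=> B D S; set W := V * Q * (Q * P ^+ 4) / P.
set c := _ / _ in S; have c0 : 0 <= c by rewrite divr_ge0 // ?mulr_ge0 ?exprn_ge0 ?ltW.
rewrite -(ler_pM2l Q0); apply: le_trans S _.
(* The saving [2 ^ (5 p)] pays exactly for the multiplicities and leaves a factor [1 / P]. *)
have e1 : c * X <= Q * W.
  apply: le_trans (ler_wpM2l c0 B) _; rewrite le_eqVlt; apply/orP; left; apply/eqP.
  by rewrite /c /W; field; rewrite ?P0' ?Q0' ?V0'.
have e2 : Y <= 2 * (Q * W).
  by apply: le_trans D _; rewrite le_eqVlt; apply/orP; left; apply/eqP; rewrite /W; ring.
have e3 : Q * P ^+ 4 * Q / (Q * P ^+ 2) * (V * Q * Q) <= Q * W.
  have -> : Q * P ^+ 4 * Q / (Q * P ^+ 2) * (V * Q * Q) = V * Q ^+ 3 * P ^+ 2 * 1.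
    by field; rewrite ?P0' ?Q0' ?V0'.
  have -> : Q * W = V * Q ^+ 3 * P ^+ 2 * P by rewrite /W; field.
  by rewrite ler_wpM2l // !mulr_ge0 ?exprn_ge0 ?ltW.
lra.
Qed.

Lemma sum_diag_le n (f : nat -> nat -> R) A B : 0 <= A -> 0 <= B ->
  (forall s, (s < n)%N -> f s s <= A) ->
  (forall s s', (s < n)%N -> (s' < n)%N -> s != s' -> f s s' <= B) ->
  \sum_(s < n) \sum_(s' < n) f s s' <= n%:R * (A + n%:R * B).
Proof.
move=> A0 B0 hA hB.
apply: (@le_trans _ _ (\sum_(s < n) (A + n%:R * B))); last first.
  by rewrite sumr_const card_ord -[X in X <= _]mulr_natl.
apply: ler_sum => s _; rewrite (bigD1 s) //= lerD ?hA //.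
apply: (@le_trans _ _ (\sum_(s' < n | s' != s) B)).
  by apply: ler_sum => s' ne; apply: hB => //; rewrite eq_sym.
rewrite sumr_const -[X in X <= _]mulr_natl ler_wpM2r // ler_nat.
by rewrite (leq_trans (max_card _)) // card_ord.
Qed.

(** The second van der Corput step. Shifting [n] by multiples of [2 ^ m] does not change the lowest
    [m] digits, whose signs therefore square to 1 and leave [box]. Pairs with [s = s'] are estimated
    trivially. *)
Lemma sum_truncated_sqr_le p q v j r r' : admissible p q v ->
  (r < 2 ^ p)%N -> (r' < 2 ^ p)%N -> r != r' ->
  \sum_(d < 2 ^ (v + q))
     (\sum_(n < 2 ^ (q + 4 * p)) low_sign R (v + (q + 2 * p)) (n * d + j d + r * d)
         * low_sign R (v + (q + 2 * p)) (n * d + j d + r' * d)) ^+ 2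
  <= 48 * (2 ^+ (v + q) * 2 ^+ (q + 4 * p) ^+ 2 / 2 ^+ p).
Proof.
move=> adm hr hr' nr; set m := (q + 2 * p)%N; set N := (q + 4 * p)%N.
pose a d n : R := low_sign R (v + m) (n * d + j d + r * d)
         * low_sign R (v + m) (n * d + j d + r' * d).
have a1 d n : `|a d n| <= 1 by rewrite normrM !normr_low_sign mulr1.
pose bx d s s' n := box R v m d r r' s s' (n * d + j d)%N.
have prod d s s' n : a d (n + s * 2 ^ m)%N * a d (n + s' * 2 ^ m)%N = bx d s s' n.
  have e b i : low_sign R (v + m) ((n + i * 2 ^ m) * d + j d + b * d)
     = low_sign R m (n * d + j d + b * d)
       * low_sign R v ((n * d + j d + b * d) %/ 2 ^ m + i * d).
    have -> : ((n + i * 2 ^ m) * d + j d + b * d = i * d * 2 ^ m + (n * d + j d + b * d))%N by ring.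
    rewrite addnC low_signD divnMDl ?expn_gt0 // [(i * d + _)%N]addnC; congr (_ * _).
    by apply: low_sign_congr; rewrite modnMDl.
  rewrite /a !e /bx /box.
  set A := low_sign R m _; set B := low_sign R m _.
  have AA : A * A = 1 by apply: low_sign_sqr.
  have BB : B * B = 1 by apply: low_sign_sqr.
  set c1 := low_sign R v _; set c2 := low_sign R v _.
  set c3 := low_sign R v _; set c4 := low_sign R v _.
  have -> : A * c1 * (B * c2) * (A * c3 * (B * c4)) = (A * A) * (B * B) * (c1 * c3 * c2 * c4) by ring.
  by rewrite AA BB !mul1r.
have vdc d := van_der_corput (2 ^ N) (2 ^ p) (2 ^ m) (a1 d).
have S := ler_sum (index_enum _) (P := xpredT) (fun (d : 'I_(2 ^ (v + q))) _ => vdc d).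
move: S; rewrite big_split /= -mulr_sumr sumr_const card_ord.
under eq_bigr do rewrite exprMn.
rewrite -mulr_sumr -[_ *+ 2 ^ (v + q)]mulr_natl.
set X := \sum_(d < _) _ ^+ 2; set Y := \sum_(d < _) _.
have Yle : Y <= (2 ^ p)%:R * (2 ^+ (v + q) * 2 ^+ N
     + (2 ^ p)%:R * (19 * (2 ^+ (v + q) * 2 ^+ N / 2 ^+ p))).
  rewrite /Y exchange_big /=; under eq_bigr do rewrite exchange_big /=.
  apply: (@sum_diag_le _ (fun s s' => \sum_(d < 2 ^ (v + q)) \sum_(n < 2 ^ N)
     a d (n + s * 2 ^ m)%N * a d (n + s' * 2 ^ m)%N)).
  - by rewrite mulr_ge0 ?exprn_ge0.
  - by rewrite !mulr_ge0 ?invr_ge0 ?exprn_ge0.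
  - move=> s _; apply: (@le_trans _ _ (\sum_(d < 2 ^ (v + q)) \sum_(n < 2 ^ N) 1)).
      apply: ler_sum => d _; apply: ler_sum => n _; apply: le_trans (ler_norm _) _.
      by rewrite normrM mulr_ile1.
    by rewrite !sumr_const !card_ord -mulrnA -natrX mulnC natrM !natrX.
  - move=> s s' hs hs' ns; apply: le_trans (sum_box_terms_le j adm hr hr' hs hs' nr ns).
    by apply: ler_sum => d _; rewrite (eq_bigr (fun n : 'I__ => bx d s s' n)) ?ler_norm.
move: Yle; rewrite !natrX expr2D2 expr2D4 exprD.
have P1 : 1 <= (2 : R) ^+ p by rewrite exprn_ege1 // ler1n.
have Q0 : 0 < (2 : R) ^+ q by rewrite exprn_gt0.
have V0 : 0 < (2 : R) ^+ v by rewrite exprn_gt0.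
move: P1 Q0 V0; set P := 2 ^+ p; set Q := 2 ^+ q; set V := 2 ^+ v.
move=> P1 Q0 V0 Yle S; have P0 : 0 < P by apply: lt_le_trans P1.
have P0' := lt0r_neq0 P0.
set Z := V * Q * (Q * P ^+ 4) ^+ 2 / P.
have Z0 : 0 <= P * Z by rewrite /Z !mulr_ge0 ?invr_ge0 ?exprn_ge0 ?mulr_ge0 ?exprn_ge0 ?ltW.
rewrite -(@ler_pM2l _ (P ^+ 2)) ?exprn_gt0 //; apply: le_trans S _.
have e1 : 2 * (Q * P ^+ 4) * Y <= 40 * (P ^+ 2 * Z).
  have c0 : 0 <= 2 * (Q * P ^+ 4) by rewrite !mulr_ge0 ?exprn_ge0 ?ltW.
  apply: le_trans (ler_wpM2l c0 Yle) _; rewrite le_eqVlt; apply/orP; left; apply/eqP.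
  by rewrite /Z; field.
have e2 : V * Q * (8 * P ^+ 4 * (Q * P ^+ 2) ^+ 2) <= 8 * (P ^+ 2 * Z).
  have -> : V * Q * (8 * P ^+ 4 * (Q * P ^+ 2) ^+ 2) = 8 * (P * Z * 1) by rewrite /Z; field.
  have -> : P ^+ 2 * Z = P * Z * P by ring.
  by rewrite !ler_wpM2l.
lra.
Qed.

(** Adding [r d], with [r < 2 ^ p] and [d < 2 ^ (v + q)], can carry past the truncation only from
    points near the end of a period; these are the points counted here. *)
Lemma sum_carry_le p q v j : admissible p q v ->
  \sum_(d < 2 ^ (v + q)) \sum_(n < 2 ^ (q + 4 * p))
     ((2 ^ (v + (q + 2 * p)) <= (n * d + j d) %% 2 ^ (v + (q + 2 * p)) + 2 ^ (p + (v + q)))%N)%:R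
  <= 4 * (2 ^+ (v + q) * 2 ^+ (q + 4 * p) / 2 ^+ p) :> R.
Proof.
move=> adm; have D := sum_deviation_le j adm.
set l := (v + (q + 2 * p))%N in D *; set c := (2 ^ (p + (v + q)))%N.
pose bad x := (2 ^ l <= x %% 2 ^ l + c)%N.
have hb x i : bad x -> (i < 2 ^ q)%N -> ((x + i + c) %% 2 ^ l < c + 2 ^ q)%N.
  rewrite /bad => b ti; have lt : (x %% 2 ^ l < 2 ^ l)%N by rewrite ltn_mod expn_gt0.
  rewrite -addnA -modnDml.
  have -> : (x %% 2 ^ l + (i + c) = 1 * 2 ^ l + (x %% 2 ^ l + c - 2 ^ l + i))%N by lia.
  by rewrite modnMDl (leq_ltn_trans (leq_mod _ _)) //; lia.
have S := ler_sum (index_enum _) (P := xpredT) (fun (d : 'I_(2 ^ (v + q))) _ =>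
  @sum_bad_le R l l (2 ^ (q + 4 * p)) (2 ^ q) d (j d) c (c + 2 ^ q) bad (leqnn l) hb).
move: S; rewrite -mulr_sumr big_split /= sumr_const card_ord -[_ *+ 2 ^ (v + q)]mulr_natl.
move: D; rewrite natrM natrD /c !natrX expr2D4 /l (exprD _ v (q + 2 * p)) expr2D2 (exprD _ p) (exprD _ v q).
have P1 : 1 <= (2 : R) ^+ p by rewrite exprn_ege1 // ler1n.
have Q0 : 0 < (2 : R) ^+ q by rewrite exprn_gt0.
have V1 : 1 <= (2 : R) ^+ v by rewrite exprn_ege1 // ler1n.
set X := \sum_(d < _) _; set Y := \sum_(d < _) _; rewrite -/Y.
move: P1 Q0 V1; set P := 2 ^+ p; set Q := 2 ^+ q; set V := 2 ^+ v.
move=> P1 Q0 V1; have P0 : 0 < P by apply: lt_le_trans P1.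
have V0 : 0 < V by apply: lt_le_trans V1.
have P0' := lt0r_neq0 P0; have Q0' := lt0r_neq0 Q0; have V0' := lt0r_neq0 V0.
move=> D S; set W := V * Q * (Q * P ^+ 4) / P; rewrite -(ler_pM2l Q0).
apply: le_trans S _.
have e2 : X <= 2 * (Q * W).
  by apply: le_trans D _; rewrite le_eqVlt; apply/orP; left; apply/eqP; rewrite /W; ring.
have e1 : V * Q * (Q * P ^+ 4 * Q / (V * (Q * P ^+ 2)) * (P * (V * Q) + Q)) <= 2 * (Q * W).
  have -> : V * Q * (Q * P ^+ 4 * Q / (V * (Q * P ^+ 2)) * (P * (V * Q) + Q))
      = Q ^+ 3 * P ^+ 2 * (P * V + 1).
    by field; rewrite ?P0' ?Q0' ?V0'.
  have -> : 2 * (Q * W) = Q ^+ 3 * P ^+ 2 * (P * V + P * V) by rewrite /W; field.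
  apply: ler_wpM2l; first by rewrite mulr_ge0 ?exprn_ge0 ?ltW.
  by rewrite lerD2l mulr_ege1.
lra.
Qed.

Lemma thue_morse_carry_free l x i : (x %% 2 ^ l + i < 2 ^ l)%N ->
  t (x + i) = t (x %/ 2 ^ l) * low_sign R l (x + i).
Proof.
move=> h; rewrite {1}(thue_morse_low R l) -[(x + i)%N]addn0.
by rewrite divn_add_small ?expn_gt0 ?addn0.
Qed.

(** The first van der Corput step. The saving [2 ^ (4 g)] for squares of truncated sums becomes
    [2 ^ (2 g)] for the sums themselves and, after another square root, [2 ^ g]. *)
Lemma sum_thue_morse_dilates_le g q v j : admissible (4 * g) q v ->
  \sum_(d < 2 ^ (v + q)) `|\sum_(n < 2 ^ (q + 4 * (4 * g))) t (n * d + j d)|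
  <= 7 * (2 ^+ (v + q) * 2 ^+ (q + 4 * (4 * g)) / 2 ^+ g).
Proof.
set p := (4 * g)%N => adm; set N := (q + 4 * p)%N; set k := (v + q)%N.
set l := (v + (q + 2 * p))%N.
have C := sum_carry_le j adm; rewrite -/k -/N -/l in C.
pose bad d n := (2 ^ l <= (n * d + j d) %% 2 ^ l + 2 ^ (p + k))%N.
have EP : (2 : R) ^+ p = 2 ^+ g ^+ 4 by rewrite /p mulnC exprM.
have EN : (2 : R) ^+ N = 2 ^+ q * 2 ^+ p ^+ 4 by rewrite /N expr2D4.
have G1 : 1 <= (2 : R) ^+ g by rewrite exprn_ege1 // ler1n.
have G0 : 0 < (2 : R) ^+ g by apply: lt_le_trans G1.
have G0' := lt0r_neq0 G0.
have Q1 : 1 <= (2 : R) ^+ q by rewrite exprn_ege1 // ler1n.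
have K0 : 0 <= (2 : R) ^+ k by rewrite exprn_ge0.
have N0 : 0 <= (2 : R) ^+ N by rewrite exprn_ge0.
pose U r r' d := \sum_(n < 2 ^ N) low_sign R l (n * d + j d + r * d)
         * low_sign R l (n * d + j d + r' * d).
have hU r r' : (r < 2 ^ p)%N -> (r' < 2 ^ p)%N -> r != r' ->
    \sum_(d < 2 ^ k) `|U r r' d| <= 7 * (2 ^+ k * 2 ^+ N / 2 ^+ g ^+ 2).
  move=> hr hr' nr; have := sum_truncated_sqr_le j adm hr hr' nr.
  rewrite -/k -/N -/l EP => h.
  rewrite -(@ler_pXn2r _ 2) // ?nnegrE; last 2 first.
  - exact: sumr_ge0.
  - by rewrite !mulr_ge0 // invr_ge0 exprn_ge0 // ltW.
  apply: le_trans (sum_ord_sqr_le _ (fun d => `|U r r' d|)) _.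
  under eq_bigr do rewrite real_normK ?num_real //.
  rewrite natrX; apply: le_trans (ler_wpM2l K0 h) _.
  have -> : (7 * (2 ^+ k * 2 ^+ N / 2 ^+ g ^+ 2)) ^+ 2
     = 49 * (2 ^+ k * (2 ^+ k * 2 ^+ N ^+ 2 / 2 ^+ g ^+ 4)) :> R by field.
  rewrite mulrCA ler_wpM2r ?ler_nat // !mulr_ge0 ?exprn_ge0 // invr_ge0 exprn_ge0 // ltW //.
have hS r r' (d : 'I_(2 ^ k)) : (r < 2 ^ p)%N -> (r' < 2 ^ p)%N ->
    `|\sum_(n < 2 ^ N) t (n * d + j d + r * d) * t (n * d + j d + r' * d)|
    <= `|U r r' d| + 2 * \sum_(n < 2 ^ N) (bad d n)%:R.
  move=> hr hr'; rewrite -lerBlDl; apply: le_trans (lerB_dist _ _) _.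
  rewrite /U -sumrB mulr_sumr; apply: le_trans (ler_norm_sum _ _ _) _.
  apply: ler_sum => n _; have [b|nb] := boolP (bad d n).
    apply: le_trans (ler_normB _ _) _.
    by rewrite !normrM !normr_low_sign !normr_thue_morse /=; lra.
  have lt i : (i < 2 ^ p)%N -> ((n * d + j d) %% 2 ^ l + i * d < 2 ^ l)%N.
    move=> ip; move: nb; rewrite /bad -ltnNge; apply: leq_ltn_trans.
    by rewrite leq_add2l expnD leq_mul // ltnW.
  (* Without carries the digits above the lowest [l] are the same in both factors, so their signs
     cancel. *)
  rewrite !(@thue_morse_carry_free l) ?lt //.
  by rewrite mulrACA thue_morse_sqr mul1r subrr normr0 mulr0.
pose a d n := t (n * d + j d).
have a1 d n : `|a d n| <= 1 by rewrite normr_thue_morse.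
have S := ler_sum (index_enum _) (P := xpredT) (fun (d : 'I_(2 ^ k)) _ =>
  van_der_corput (2 ^ N) (2 ^ p) 1 (a1 d)).
move: S; rewrite big_split /= -mulr_sumr sumr_const card_ord.
under eq_bigr do rewrite exprMn.
rewrite -mulr_sumr -[_ *+ 2 ^ k]mulr_natl.
set X := \sum_(d < _) _ ^+ 2; set Y := \sum_(d < _) _.
(* Off the diagonal [15 = 7 + 2 * 4]: the truncated sums and twice the carries. *)
have Yle : Y <= (2 ^ p)%:R * (2 ^+ k * 2 ^+ N
     + (2 ^ p)%:R * (15 * (2 ^+ k * 2 ^+ N / 2 ^+ g ^+ 2))).
  rewrite /Y exchange_big /=; under eq_bigr do rewrite exchange_big /=.
  apply: (@sum_diag_le _ (fun s s' => \sum_(d < 2 ^ k) \sum_(n < 2 ^ N)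
     a d (n + s * 1)%N * a d (n + s' * 1)%N)).
  - by rewrite mulr_ge0 ?exprn_ge0.
  - by rewrite !mulr_ge0 ?invr_ge0 ?exprn_ge0.
  - move=> s _; apply: (@le_trans _ _ (\sum_(d < 2 ^ k) \sum_(n < 2 ^ N) 1)).
      apply: ler_sum => d _; apply: ler_sum => n _; apply: le_trans (ler_norm _) _.
      by rewrite normrM mulr_ile1.
    by rewrite !sumr_const !card_ord -mulrnA -natrX mulnC natrM !natrX.
  - move=> r r' hr hr' nr.
    apply: (@le_trans _ _ (\sum_(d < 2 ^ k) (`|U r r' d| + 2 * \sum_(n < 2 ^ N) (bad d n)%:R))).
      apply: ler_sum => d _; apply: le_trans (hS r r' d hr hr').
      apply: le_trans (ler_norm _) _; rewrite le_eqVlt; apply/orP; left; apply/eqP.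
      congr `| _ |; apply: eq_bigr => n _; rewrite /a.
      by congr (t _ * t _); ring.
    rewrite big_split -mulr_sumr /=; have := hU _ _ hr hr' nr.
    move: C; rewrite EP -/(bad _ _).
    have : 2 ^+ k * 2 ^+ N / 2 ^+ g ^+ 4 <= 2 ^+ k * 2 ^+ N / 2 ^+ g ^+ 2 :> R.
      rewrite ler_wpM2l ?mulr_ge0 // lef_pV2 ?posrE ?exprn_gt0 //.
      by rewrite ler_weXn2l.
    rewrite /bad; lra.
move: Yle; rewrite !natrX expr1n mulr1 => Yle S.
rewrite -(@ler_pXn2r _ 2) // ?nnegrE; last 2 first.
- exact: sumr_ge0.
- by rewrite !mulr_ge0 // invr_ge0 ltW.
apply: le_trans (sum_ord_sqr_le _ (fun d => `|\sum_(n < 2 ^ N) t (n * d + j d)|)) _.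
under eq_bigr do rewrite real_normK ?num_real //.
rewrite natrX -/X.
suff XS : X <= 49 * (2 ^+ k * 2 ^+ N ^+ 2 / 2 ^+ g ^+ 2).
  apply: le_trans (ler_wpM2l K0 XS) _; rewrite le_eqVlt; apply/orP; left; apply/eqP; by field.
move: S Yle; rewrite EN EP; move: G1 G0 G0' Q1 K0.
set K := 2 ^+ k; set Q := 2 ^+ q; set G := 2 ^+ g => G1 G0 G0' Q1 K0 S Yle.
have Q0 : 0 < Q by apply: lt_le_trans Q1.
set Z := K * (Q * G ^+ 4 ^+ 4) ^+ 2 / G ^+ 2.
have P0 : 0 < G ^+ 4 ^+ 2 by rewrite !exprn_gt0.
rewrite -(ler_pM2l P0); apply: le_trans S _.
have e1 : 2 * (Q * G ^+ 4 ^+ 4) * Y <= G ^+ 4 ^+ 2 * (32 * Z).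
  have c0 : 0 <= 2 * (Q * G ^+ 4 ^+ 4) by rewrite !mulr_ge0 ?exprn_ge0 ?ltW.
  apply: le_trans (ler_wpM2l c0 Yle) _.
  have -> : 2 * (Q * G ^+ 4 ^+ 4) * (G ^+ 4 * (K * (Q * G ^+ 4 ^+ 4)
       + G ^+ 4 * (15 * (K * (Q * G ^+ 4 ^+ 4) / G ^+ 2))))
     = 2 * K * Q ^+ 2 * G ^+ 36 * 1 + 30 * K * Q ^+ 2 * G ^+ 38 by field.
  have -> : G ^+ 4 ^+ 2 * (32 * Z) = 2 * K * Q ^+ 2 * G ^+ 36 * G ^+ 2 + 30 * K * Q ^+ 2 * G ^+ 38.
    by rewrite /Z; field.
  rewrite lerD2r; apply: ler_wpM2l; last by rewrite exprn_ege1.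
  by rewrite !mulr_ge0 ?exprn_ge0 ?ltW.
have e2 : K * (8 * G ^+ 4 ^+ 4) <= G ^+ 4 ^+ 2 * (8 * Z).
  have -> : K * (8 * G ^+ 4 ^+ 4) = 8 * K * G ^+ 16 * 1 by ring.
  have -> : G ^+ 4 ^+ 2 * (8 * Z) = 8 * K * G ^+ 16 * (Q ^+ 2 * G ^+ 22) by rewrite /Z; field.
  apply: ler_wpM2l; last by apply: mulr_ege1; apply: exprn_ege1.
  by rewrite !mulr_ge0 ?exprn_ge0 ?ltW.
have Z0 : 0 <= G ^+ 4 ^+ 2 * Z.
  by rewrite /Z !mulr_ge0 ?invr_ge0 ?exprn_ge0 ?mulr_ge0 ?exprn_ge0 ?ltW.
lra.
Qed.

End ModulusAverage.

(** * Dyadic decomposition *)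

Lemma sum_residue_class (V : nmodType) (f : nat -> V) Y d r : (r < d)%N ->
  \sum_(m < Y | (m %% d == r)%N) f m
    = \sum_(n < (Y + (d - 1 - r)) %/ d) f (n * d + r)%N.
Proof.
move=> rd; have d0 : (0 < d)%N by apply: leq_ltn_trans rd.
set c := ((Y + (d - 1 - r)) %/ d)%N.
have nc n : (n * d + r < Y)%N = (n < c)%N.
  by rewrite /c leq_divRL // mulSn; lia.
pose g m : V := if (m < Y)%N && (m %% d == r)%N then f m else 0.
have le : (Y <= (Y %/ d + 1) * d)%N.
  by rewrite {1}(divn_eq Y d) mulnDl mul1n leq_add2l ltnW // ltn_mod.
have cle : (c <= Y %/ d + 1)%N.
  by rewrite -ltnS /c ltn_divLR // mulSn; have := ltn_ceil Y d0; lia.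
have -> : \sum_(m < Y | (m %% d == r)%N) f m = \sum_(m < (Y %/ d + 1) * d) g m.
  rewrite (big_ord_split g le) [X in _ + X]big1 ?addr0 => [|m _]; last first.
    by rewrite /g ltnNge leq_addr.
  by rewrite big_mkcond; apply: eq_bigr => m _; rewrite /g ltn_ord.
rewrite (big_ord_mul g).
have inner n : \sum_(i < d) g (n * d + i)%N = if (n < c)%N then f (n * d + r)%N else 0.
  rewrite (bigD1 (Ordinal rd)) //= big1 => [|i ir]; last first.
    rewrite /g modnMDl (modn_small (ltn_ord i)).
    by case: eqP => [e|_]; [case/eqP: ir; apply: val_inj|rewrite andbF].
  by rewrite addr0 /g modnMDl (modn_small rd) eqxx andbT nc.
under eq_bigr do rewrite inner.
rewrite (big_ord_split (fun n => if (n < c)%N then f (n * d + r)%N else 0) cle).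
rewrite [X in _ + X]big1 ?addr0 => [|n _]; last by rewrite ltnNge leq_addr.
by apply: eq_bigr => n _; rewrite ltn_ord.
Qed.

Section Assembly.
Variable R : realType.
Local Notation t := (thue_morse R).
Implicit Types (B L N X c d g j k s x y : nat) (F : nat -> R).

(** With [p = 4 g], the choice [q = uphalf k + 4 g] is the least for which [v = k - q] satisfies
    [v + 2 p <= q]. The other conditions hold because [k] is at least a large multiple of [g]. *)
Lemma admissible_exists : exists2 B0, (0 < B0)%N &
  forall g k, (B0 * g <= k)%N -> exists v, (v + (uphalf k + 4 * g) = k)%N /\
    admissible R (4 * g) (uphalf k + 4 * g) v.
Proof.
have [Q Q0 hQ] := corr_total_bound R.
exists (200 * (Q + 1))%N => [|g k hk]; first by lia.
have gk : (200 * g <= k)%N by apply: leq_trans hk; rewrite leq_mul2r leq_pmulr ?orbT // addn1.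
have gQk : (40 * (g * Q) + 8 * g <= k)%N.
  by apply: leq_trans hk; rewrite mulnDr mulnDl !muln1; nia.
have vk : (uphalf k + 4 * g <= k)%N by lia.
exists (k - (uphalf k + 4 * g))%N; split; first by rewrite subnK.
set q := (uphalf k + 4 * g)%N; set v := (k - q)%N.
split.
- by rewrite /v /q; lia.
- by rewrite /v /q; lia.
- have [e [eq e0 e16]] : exists e, [/\ (q = 4 * (4 * g) + e)%N, (0 < e)%N \/ (q = 0)%N & (16 * (4 * g) <= e)%N].
    exists (q - 4 * (4 * g))%N; split; [by rewrite /q; lia| |by rewrite /q; lia].
    by rewrite /q; lia.
  rewrite {2}eq expnD mulnC leq_pmul2l ?expn_gt0 //.
  case: e0 => [e0|q0]; last by rewrite q0; move: q0 eq; case: (e) => [|?]; lia.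
  have le2 : (2 * e <= 2 ^ e)%N.
    by case: (e) e0 => // e' _; rewrite expnS leq_pmul2l // ltn_expl.
  by apply: leq_trans le2; lia.
- apply: le_trans (hQ v (false, (0, 0, 0)%N) isT) _.
  rewrite ler_wpM2l ?exprn_ge0 // lef_pV2 ?posrE ?exprn_gt0 //.
  rewrite ler_weXn2l ?ler1n // leq_divRL //.
  by rewrite /v /q; nia.
Qed.

Definition dilate_sum c d j : R := \sum_(n < c) t (n * d + j).

Lemma dilate_sum_natr c d j : exists m : nat, `|dilate_sum c d j| = m%:R.
Proof.
have : dilate_sum c d j \is a Num.int.
  by apply: rpred_sum => n _; rewrite rpredX // rpredN rpred1.
by move=> /natr_norm_int /natrP[m ->]; exists m.
Qed.

Lemma normr_dilate_sum_le c d j : `|dilate_sum c d j| <= c%:R.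
Proof.
apply: le_trans (ler_norm_sum _ _ _) _.
by under eq_bigr do rewrite normr_thue_morse; rewrite sumr_const card_ord.
Qed.

(** The norms are natural numbers at most [N], so a worst offset exists. It serves as the offset
    depending on [d] in the averages. *)
Lemma dilate_sum_max N d : exists j0, forall j, `|dilate_sum N d j| <= `|dilate_sum N d j0|.
Proof.
pose P m := `[< exists j, `|dilate_sum N d j| = m%:R >].
have exP : exists m, P m.
  by have [m hm] := dilate_sum_natr N d 0; exists m; apply/asboolP; exists 0%N.
have ubP m : P m -> (m <= N)%N.
  by move=> /asboolP[j hj]; rewrite -(ler_nat R) -hj normr_dilate_sum_le.
case: (ex_maxnP exP ubP) => m /asboolP[j0 hj0] hm; exists j0 => j.
have [m' hm'] := dilate_sum_natr N d j.
by rewrite hj0 hm' ler_nat; apply: hm; apply/asboolP; exists j.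
Qed.

Lemma dilate_sum_blocks N d (E : R) c j : (0 < N)%N ->
  (forall j', `|dilate_sum N d j'| <= E) ->
  `|dilate_sum c d j| <= (c %/ N)%:R * E + N%:R.
Proof.
move=> N0 hE; have -> : dilate_sum c d j = \sum_(n < c %/ N * N + c %% N) t (n * d + j).
  by rewrite -divn_eq.
rewrite big_split_ord /=; apply: le_trans (ler_normD _ _) _; apply: lerD.
  rewrite (big_ord_mul (fun n => t (n * d + j))).
  apply: le_trans (ler_norm_sum _ _ _) _.
  apply: (@le_trans _ _ (\sum_(i < c %/ N) E)); last first.
    by rewrite sumr_const card_ord -[X in X <= _]mulr_natl.
  apply: ler_sum => i _; apply: le_trans (hE (i * N * d + j)%N).
  rewrite le_eqVlt; apply/orP; left; apply/eqP; congr `| _ |.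
  by apply: eq_bigr => n _; congr (t _); ring.
apply: le_trans (ler_norm_sum _ _ _) _.
under eq_bigr do rewrite normr_thue_morse.
by rewrite sumr_const card_ord ler_nat ltnW // ltn_mod.
Qed.

(* The progressions of difference d with offset below d that meet [0, X) have
   at most X / d + 1 terms there. *)
Definition progression_bound X d (b : R) :=
  forall c j, (c * d <= X + d)%N -> `|dilate_sum c d j| <= b.

(** [F d] bounds the number of blocks of length [N] times the worst block sum, plus [N] for the
    incomplete block. The total of the latter, roughly [2 ^ (3 k / 2)], confines the moduli to about
    [x ^ (2/3)]. *)
Lemma dyadic_bound : exists2 B0, (0 < B0)%N & forall B, (B0 <= B)%N ->
  forall L k, (k <= L)%N -> exists F, [/\ forall d, 0 <= F d,
    forall d, (2 ^ k <= d)%N -> progression_bound (2 ^ L) d (F d) &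
    \sum_(d < 2 ^ k.+1) F d <= 28 * (2 ^+ L / 2 ^+ (k.+1 %/ B))
      + 2 ^+ (k.+1 + uphalf k.+1 + 20 * (k.+1 %/ B))].
Proof.
have [B0 B00 hB0] := admissible_exists; exists B0 => // B BB0 L k kL.
have Bpos : (0 < B)%N by apply: leq_trans BB0.
set K := k.+1; set g := (K %/ B)%N.
have [v [vK adm]] : exists v, (v + (uphalf K + 4 * g) = K)%N /\
    admissible R (4 * g) (uphalf K + 4 * g) v.
  apply: hB0; apply: leq_trans (leq_trunc_div K B).
  by rewrite mulnC leq_mul2l BB0 orbT.
set N := (2 ^ (uphalf K + 20 * g))%N.
have N0 : (0 < N)%N by rewrite expn_gt0.
have [jf hjf] := choice (dilate_sum_max N).
have avg := sum_thue_morse_dilates_le jf adm.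
have eN : (uphalf K + 4 * g + 4 * (4 * g) = uphalf K + 20 * g)%N by lia.
rewrite vK eN -/N in avg.
pose E d := `|dilate_sum N d (jf d)|.
have {}avg : \sum_(d < 2 ^ K) E d <= 7 * (2 ^+ K * N%:R / 2 ^+ g).
  by rewrite /N natrX.
exists (fun d => (2 ^+ (L - k) + 1) / N%:R * E d + N%:R).
have N0' : 0 < N%:R :> R by rewrite ltr0n.
have c0 : 0 <= (2 ^+ (L - k) + 1) / N%:R :> R.
  by rewrite divr_ge0 // addr_ge0 ?exprn_ge0.
split=> [d|d kd c j cd|].
- by rewrite addr_ge0 // mulr_ge0 // normr_ge0.
- apply: le_trans (dilate_sum_blocks c j N0 (hjf d)) _.
  rewrite lerD2r ler_wpM2r // ler_pdivlMr // -natrM.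
  have le1 : (c %/ N * N <= c)%N by apply: leq_trunc_div.
  have le2 : (c <= 2 ^ (L - k) + 1)%N.
    have d0 : (0 < d)%N by apply: leq_trans kd; rewrite expn_gt0.
    rewrite -(leq_pmul2r d0); apply: leq_trans cd _.
    by rewrite mulnDl mul1n leq_add2r -{1}(subnK kL) expnD leq_mul2l kd orbT.
  by rewrite -natrX -(natrD _ _ 1) ler_nat (leq_trans le1).
- rewrite big_split /= -mulr_sumr sumr_const card_ord -[_ *+ 2 ^ _]mulr_natl.
  rewrite -/K natrX -addnA exprD.
  have -> : (2 : R) ^+ (uphalf K + 20 * g) = N%:R by rewrite /N natrX.
  rewrite lerD2r; apply: le_trans (ler_wpM2l c0 avg) _.
  have -> : (2 ^+ (L - k) + 1) / N%:R * (7 * (2 ^+ K * N%:R / 2 ^+ g))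
    = 14 * (((2 ^+ (L - k) + 1) * 2 ^+ k) / 2 ^+ g) :> R.
    rewrite /K exprS; field.
    by rewrite !lt0r_neq0 ?exprn_gt0.
  have -> : 28 * (2 ^+ L / 2 ^+ g) = 14 * (2 ^+ L * 2 / 2 ^+ g) :> R by ring.
  rewrite ler_wpM2l // ler_wpM2r ?invr_ge0 ?exprn_ge0 //.
  have -> : 2 ^+ L * 2 = 2 ^+ L + 2 ^+ L :> R by ring.
  by rewrite mulrDl -exprD subnK // mul1r lerD2l ler_weXn2l ?ler1n.
Qed.

(** * Small moduli and the sum over dyadic ranges *)

Lemma progression_bound_multiple X d K (b : R) : (0 < K)%N ->
  progression_bound X (K * d) b -> progression_bound X d (K%:R * b).
Proof.
move=> K0 hb c j cd.
have lt (m : 'I_c) : (m %% K < K)%N by rewrite ltn_mod.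
rewrite /dilate_sum (partition_big (fun m => Ordinal (lt m)) predT) //=.
apply: le_trans (ler_norm_sum _ _ _) _.
apply: (@le_trans _ _ (\sum_(i < K) b)); last first.
  by rewrite sumr_const card_ord -[X in X <= _]mulr_natl.
apply: ler_sum => i _.
rewrite (eq_bigl (fun m : 'I_c => (m %% K == i)%N)) //.
rewrite (sum_residue_class (fun n => t (n * d + j)) c (ltn_ord i)).
set ci := ((c + (K - 1 - i)) %/ K)%N.
have -> : \sum_(n < ci) t ((n * K + i) * d + j) = dilate_sum ci (K * d) (i * d + j).
  by apply: eq_bigr => n _; congr (t _); ring.
(* Rounding up costs at most [(K - 1) d], exactly the gain from [X + d] to [X + K d]. *)
apply: hb; have : (ci * K <= c + (K - 1 - i))%N by apply: leq_trunc_div.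
move=> h; rewrite mulnA; apply: leq_trans (leq_mul h (leqnn d)) _.
have : ((c + (K - 1 - i)) * d <= (c + (K - 1)) * d)%N.
  by rewrite leq_mul2r leq_add2l leq_subr orbT.
move=> /leq_trans; apply; rewrite mulnDl.
have -> : (X + K * d = X + d + (K - 1) * d)%N by rewrite -addnA -mulSn subn1 prednK.
by rewrite leq_add2r.
Qed.

(* A progression of difference [d] splits into [K] progressions of difference
   [K * d]; averaging over [K] close to [2 ^ k / d] reduces to large moduli. *)
Lemma small_modulus_bound L k d F : (forall e, 0 <= F e) ->
  (forall e, (2 ^ k <= e)%N -> progression_bound (2 ^ L) e (F e)) ->
  (0 < d)%N -> (2 * d <= 2 ^ k)%N ->
  progression_bound (2 ^ L) d (6 * \sum_(e < 2 ^ k.+1) F e).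
Proof.
move=> F0 hF d0 dk c j cd.
set y := (2 ^ k %/ d)%N.
have y2 : (2 <= y)%N by rewrite /y leq_divRL.
have ylo : (2 ^ k < y.+1 * d)%N by rewrite /y ltn_ceil.
have yhi : (y * d <= 2 ^ k)%N by apply: leq_trunc_div.
set S := \sum_(e < 2 ^ k.+1) F e.
have one K : (y < K)%N -> `|dilate_sum c d j| <= K%:R * F (K * d)%N.
  move=> yK; have K0 : (0 < K)%N by apply: leq_ltn_trans yK.
  apply: (progression_bound_multiple K0 (hF _ _)) => //.
  by apply: leq_trans (ltnW ylo) _; rewrite leq_mul2r yK orbT.
(* Here [K] runs over [y < K < 2 y], so every [K d] lies between [2 ^ k] and [2 ^ k.+1]. As
   [2 y <= 6 (y - 1)], averaging over these [y - 1] values costs a factor 6. *)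
have le1 : (y - 1)%:R * `|dilate_sum c d j| <= \sum_(i < y - 1) (2 * y)%:R * F ((y + 1 + i) * d)%N.
  have -> : (y - 1)%:R * `|dilate_sum c d j| = \sum_(i < y - 1) `|dilate_sum c d j|.
    by rewrite sumr_const card_ord mulr_natl.
  apply: ler_sum => i _; apply: le_trans (one (y + 1 + i)%N _) _; first by lia.
  by rewrite ler_wpM2r // ler_nat; have := ltn_ord i; lia.
have le2 : \sum_(i < y - 1) F ((y + 1 + i) * d)%N <= S.
  apply: (@le_trans _ _ (\sum_(K < 2 * y) F (K * d)%N)).
    have -> : (2 * y = y + 1 + (y - 1))%N by lia.
    by rewrite big_split_ord /= lerDr sumr_ge0.
  apply: (@le_trans _ _ (\sum_(e < 2 * y * d) F e)).
    rewrite (big_ord_mul F); apply: ler_sum => K _.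
    by rewrite (bigD1 (Ordinal d0)) //= addn0 lerDl sumr_ge0.
  apply: ler_sum_ord_widen => //.
  by rewrite expnS -mulnA leq_pmul2l.
have S0 : 0 <= S by apply: sumr_ge0.
have y1 : 0 < (y - 1)%:R :> R by rewrite ltr0n subn_gt0.
rewrite -(ler_pM2l y1); apply: le_trans le1 _; rewrite -mulr_sumr.
apply: le_trans (ler_wpM2l _ le2) _ => //.
rewrite mulrA ler_wpM2r // -[X in _ * X]/(6%:R) -natrM ler_nat; lia.
Qed.

Lemma glue_dyadic (P : nat -> R -> Prop) k0 k1 (A0 A : R) :
  (k0 <= k1)%N -> 0 <= A ->
  (exists F, [/\ forall d, 0 <= F d, forall d, (0 < d < 2 ^ k0)%N -> P d (F d) &
     \sum_(d < 2 ^ k0) F d <= A0]) ->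
  (forall k, (k0 <= k < k1)%N -> exists F, [/\ forall d, 0 <= F d,
     forall d, (2 ^ k <= d < 2 ^ k.+1)%N -> P d (F d) & \sum_(d < 2 ^ k.+1) F d <= A]) ->
  exists F, [/\ forall d, 0 <= F d, forall d, (0 < d < 2 ^ k1)%N -> P d (F d) &
     \sum_(d < 2 ^ k1) F d <= A0 + k1%:R * A].
Proof.
move=> k01 Apos base step.
suff [F [h1 h2 h3]] : exists F, [/\ forall d, 0 <= F d,
    forall d, (0 < d < 2 ^ k1)%N -> P d (F d) &
     \sum_(d < 2 ^ k1) F d <= A0 + (k1 - k0)%:R * A].
  exists F; split=> //; apply: le_trans h3 _.
  by rewrite lerD2l ler_wpM2r // ler_nat leq_subr.
move: (k1 - k0)%N (subnKC k01) => i e; subst k1; clear k01.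
elim: i step => [|i IH] step.
  by rewrite addn0 mul0r addr0.
have [k hk|F [F0 hF sF]] := IH; first by apply: step; lia.
have [|F' [F'0 hF' sF']] := step (k0 + i)%N; first by lia.
exists (fun d => if (d < 2 ^ (k0 + i))%N then F d else F' d); split.
- by move=> d; case: ifP.
- rewrite addnS => d /andP[d0 dk]; case: ltnP => h; first by apply: hF; rewrite d0.
  by apply: hF'; rewrite h dk.
rewrite addnS; have le : (2 ^ (k0 + i) <= 2 ^ (k0 + i).+1)%N by rewrite leq_exp2l.
rewrite -natr1 mulrDl mul1r addrA (big_ord_split (fun d => if (d < 2 ^ (k0 + i))%N then F d else F' d) le); apply: lerD.
  by apply: le_trans sF; apply: ler_sum => d _; rewrite ltn_ord.
apply: le_trans sF'; rewrite (big_ord_split F' le).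
rewrite -[X in X <= _]add0r lerD ?sumr_ge0 //.
by apply: ler_sum => d _; rewrite ltnNge leq_addr.
Qed.

(** The exponent 2/3 enters here. With [u = L %/ w], the last hypothesis puts [3 K / 2] below [L] by
    about [3 u / 2]; of this, [u / 2] pays for the digits [20 (K %/ B)] and [u] for [2 s]. *)
Lemma exponent_bound L w B s K : (0 < w)%N -> (40 * w <= B)%N -> (2 * w * s <= L)%N ->
  (3 * K + 3 * (L %/ w) <= 2 * L + 3)%N ->
  (K + uphalf K + 20 * (K %/ B) + 2 * s <= L + 3)%N.
Proof.
move=> w0 hB hs hK; set u := (L %/ w)%N in hK *; set g := (K %/ B)%N.
have hu : (L < u.+1 * w)%N by apply: ltn_ceil.
have hg : (g * B <= K)%N by apply: leq_trunc_div.
have hsu : (2 * s <= u)%N by rewrite leq_divRL // mulnAC.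
have hgu : (40 * g <= u.+1)%N.
  rewrite -(leq_pmul2r w0) mulnAC; have : (40 * w * g <= g * B)%N by rewrite mulnC leq_mul2l hB orbT.
  lia.
lia.
Qed.

(** Moduli below [2 ^ k0] are reduced to moduli near [2 ^ (L / 2)]; every larger dyadic range saves
    [2 ^ (2 s)] by itself. At most [M 2 ^ s] ranges occur, so a saving of [2 ^ s] remains. *)
Lemma progression_bounds_sum w : (8 <= w)%N ->
  exists M, exists C : R, [/\ (0 < M)%N, 0 <= C &
    forall L K, (3 * K + 3 * (L %/ w) <= 2 * L + 3)%N ->
    exists F, [/\ forall d, 0 <= F d,
      forall d, (0 < d < 2 ^ K)%N -> progression_bound (2 ^ L) d (F d) &
      \sum_(d < 2 ^ K) (1 + F d) <= C * (2 ^+ L / 2 ^+ (L %/ M))]].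
Proof.
move=> w8; have w0 : (0 < w)%N by apply: leq_trans w8.
have [B0 B00 dyadic] := dyadic_bound.
set B := (B0 + 40 * w)%N; set M := (64 * (B + 1) * (B + 1) * w)%N.
have Bpos : (0 < B)%N by rewrite /B addn_gt0 B00.
have BB0 : (B0 <= B)%N by apply: leq_addr.
have Bw : (40 * w <= B)%N by apply: leq_addl.
have M0 : (0 < M)%N by rewrite /M !muln_gt0 !addn1 /= w0.
exists M, (272 + 36 * M%:R); split=> [//||L K hK].
  by rewrite addr_ge0 ?mulr_ge0 ?ler0n.
set s := (L %/ M)%N.
have sM : (M * s <= L)%N by rewrite mulnC leq_trunc_div.
have LM : (L < M * s.+1)%N by rewrite mulnC ltn_ceil.
have f1 : (64 * ((B + 1) * s) <= L)%N.
  apply: leq_trans sM; rewrite /M -!mulnA leq_mul2l /= leq_mul2l.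
  by rewrite [(w * s)%N]mulnC !mulnA mulnC mulnA leq_pmull ?orbT // muln_gt0 w0 addn1.
have f2 : (64 * ((B + 1) * ((B + 1) * s)) <= L)%N.
  apply: leq_trans sM; rewrite /M -!mulnA !leq_mul2l /=.
  by rewrite leq_pmull ?orbT.
have f3 : (2 * w * s <= L)%N.
  apply: leq_trans sM; rewrite leq_mul2r; apply/orP; right.
  rewrite /M leq_mul2r; apply/orP; right; rewrite -mulnA.
  by apply: (@leq_trans 64) => //; rewrite leq_pmulr // muln_gt0 addn1.
(* With this [k0], every [k >= k0] has [k.+1 %/ B >= 2 s]. At level [k1] the saving exponent
   [g1 >= k0 + 2 s] also absorbs the number [2 ^ k0] of small moduli. *)
set k0 := (2 * (B * s))%N; set k1 := (L./2)%N; set g1 := (k1.+1 %/ B)%N.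
have hu : (8 * (L %/ w) <= L)%N.
  by apply: leq_trans (leq_trunc_div L w); rewrite mulnC leq_mul2l w8 orbT.
have Bs : ((B + 1) * s = B * s + s)%N by ring.
have hg1 : (k0 + 2 * s <= g1)%N.
  rewrite /g1 leq_divRL //.
  have -> : ((k0 + 2 * s) * B = 2 * (B * ((B + 1) * s)))%N by rewrite /k0; ring.
  have : (B * ((B + 1) * s) <= (B + 1) * ((B + 1) * s))%N by rewrite leq_mul2r leq_addr orbT.
  rewrite /k1; lia.
have e1 : (k0 + (k1.+1 + uphalf k1.+1 + 20 * g1) + 2 * s <= L + 4)%N.
  have hg : (g1 * B <= k1.+1)%N by apply: leq_trunc_div.
  have hgu : (40 * g1 <= (L %/ w).+1)%N.
    rewrite -(leq_pmul2r w0) mulnAC.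
    have : (40 * w * g1 <= g1 * B)%N by rewrite mulnC leq_mul2l Bw orbT.
    have := ltn_ceil L w0; rewrite /k1 in hg *; lia.
  rewrite /k0; move: f1; rewrite Bs /k1; lia.
pose Y : R := 2 ^+ L / 2 ^+ (2 * s).
have Y0 : 0 <= Y by rewrite divr_ge0 ?exprn_ge0.
have pow_le a c : (a + 2 * s <= L + c)%N -> 2 ^+ a <= 2 ^+ c * Y.
  move=> h; rewrite /Y mulrA ler_pdivlMr ?exprn_gt0 // -!exprD.
  by rewrite ler_weXn2l ?ler1n // [(c + L)%N]addnC.
have quot_le a b : (a + 2 * s <= b)%N -> 2 ^+ a * (2 ^+ L / 2 ^+ b) <= Y.
  move=> h; rewrite /Y mulrCA ler_wpM2l ?exprn_ge0 // ler_pdivrMr ?exprn_gt0 //.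
  rewrite mulrC ler_pdivlMr ?exprn_gt0 // -exprD.
  by rewrite ler_weXn2l ?ler1n.
have k1L : (k1 <= L)%N by rewrite /k1; lia.
have base : exists F, [/\ forall d, 0 <= F d,
    forall d, (0 < d < 2 ^ k0)%N -> progression_bound (2 ^ L) d (F d) &
    \sum_(d < 2 ^ k0) F d <= 264 * Y].
  have [F1 [F10 hF1 sF1]] := dyadic B BB0 L k1 k1L.
  set S := \sum_(e < _) _ in sF1.
  have S0 : 0 <= S by apply: sumr_ge0.
  exists (fun=> 6 * S); split=> [d|d /andP[d0 dk]|].
  - by rewrite mulr_ge0.
  - apply: small_modulus_bound => //.
    have s0 : (0 < s)%N 
      by rewrite lt0n; apply/eqP => s0; move: d0 dk; rewrite /k0 s0 !muln0 expn0; lia.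
    apply: (@leq_trans (2 ^ k0.+1)); first by rewrite expnS leq_pmul2l // ltnW.
    rewrite leq_exp2l //; move: f1; rewrite Bs /k0 /k1; lia.
  - rewrite sumr_const card_ord -[X in X <= _]mulr_natl natrX.
    have p0 : 0 <= (2 : R) ^+ k0 by rewrite exprn_ge0.
    apply: le_trans (_ : _ <= 6 * (28 * (2 ^+ k0 * (2 ^+ L / 2 ^+ g1))
       + 2 ^+ (k0 + (k1.+1 + uphalf k1.+1 + 20 * g1)))) _.
      rewrite mulrCA ler_wpM2l // exprD mulrCA -mulrDr ler_wpM2l //.
    have := quot_le _ _ hg1; have := pow_le _ _ e1; lra.
(* The maximum covers the case [K <= k0], where the small moduli suffice. *)
have step k : (k0 <= k < maxn K k0)%N -> exists F, [/\ forall d, 0 <= F d,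
     forall d, (2 ^ k <= d < 2 ^ k.+1)%N -> progression_bound (2 ^ L) d (F d) &
     \sum_(d < 2 ^ k.+1) F d <= 36 * Y].
  move=> /andP[k0k kK]; have {}kK : (k < K)%N by move: kK; rewrite leq_max; lia.
  have kL : (k <= L)%N by move: hK kK; move: (L %/ w)%N => u; lia.
  have [F [F0 hF sF]] := dyadic B BB0 L k kL; exists F; split=> //.
    by move=> d /andP[kd _]; apply: hF.
  apply: le_trans sF _.
  have h1 : (0 + 2 * s <= k.+1 %/ B)%N.
    rewrite leq_divRL // add0n; apply: leq_trans (leqnSn _); apply: leq_trans k0k.
    by rewrite /k0 [(B * s)%N]mulnC mulnA.
  have hk : (3 * k.+1 + 3 * (L %/ w) <= 2 * L + 3)%N.
    by apply: leq_trans hK; rewrite leq_add2r leq_mul2l.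
  have := pow_le _ _ (exponent_bound w0 Bw f3 hk).
  have := quot_le _ _ h1; rewrite expr0 mul1r; lra.
have A0 : 0 <= 36 * Y by rewrite mulr_ge0.
have [F [F0 hF sF]] := glue_dyadic (leq_maxr K k0) A0 base step.
exists F; split=> [//|d /andP[d0 dK]|].
  by apply: hF; rewrite d0 (leq_trans dK) // leq_exp2l // leq_maxl.
rewrite big_split /= sumr_const card_ord.
have sK : \sum_(d < 2 ^ K) F d <= 264 * Y + (maxn K k0)%:R * (36 * Y).
  by apply: le_trans sF; apply: ler_sum_ord_widen => //; rewrite leq_exp2l // leq_maxl.
have KY : (2 ^ K)%:R <= 8 * Y :> R.
  have h : (K + 2 * s <= L + 3)%N by have := exponent_bound w0 Bw f3 hK; move: (K %/ B)%N => g; lia.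
  by rewrite natrX; have := pow_le _ _ h; lra.
have mK : (maxn K k0)%:R <= M%:R * 2 ^+ s :> R.
  rewrite -natrX -natrM ler_nat; apply: (@leq_trans (M * s.+1)).
    apply: leq_trans LM; rewrite geq_max; apply/andP; split.
      by move: hK; move: (L %/ w)%N => u; lia.
    by move: f1; rewrite Bs /k0; lia.
  by rewrite leq_mul2l ltn_expl ?orbT.
have Z1 : (1 : R) <= 2 ^+ s by rewrite exprn_ege1 // ler1n.
have -> : 2 ^+ L / 2 ^+ s = 2 ^+ s * Y.
  by rewrite /Y mul2n -addnn exprD; field; rewrite lt0r_neq0 ?exprn_gt0.
have h1 := ler_wpM2r A0 mK.
have h2 : 1 * Y <= 2 ^+ s * Y by rewrite ler_wpM2r.
have -> : (272 + 36 * M%:R) * (2 ^+ s * Y) = 272 * (2 ^+ s * Y) + M%:R * 2 ^+ s * (36 * Y) by ring.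
lra.
Qed.

End Assembly.

(** * Discrepancies *)

Section Bridge.
Variable R : realType.

Lemma double_even_indicator m :
  2 * ((binary_ones m == 0 %[mod 2])%N : nat)%:R = 1 + thue_morse R m.
Proof.
rewrite /thue_morse -signr_odd -(modn2 (binary_ones m)) mod0n.
have : ((binary_ones m) %% 2 < 2)%N by rewrite ltn_mod.
by case: (_ %% 2)%N => [|[|//]] _ /=; rewrite ?expr1 ?expr0 ?mulr1 ?mulr0 ?subrr //; ring.
Qed.

Lemma double_A (y : R) d (j : int) : 0 <= y -> (0 < d)%N ->
  exists c r : nat, [/\ 2 * (A y d j)%:R = c%:R + dilate_sum R c d r,
    `|c%:R - y / d%:R| <= 1 & (c * d)%:R <= y + d%:R].
Proof.
move=> y0 d0; have dz : d%:Z != 0 by rewrite eqz_nat -lt0n.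
set r := `|(j %% d%:Z)%Z|%N.
have rE : r%:Z = (j %% d%:Z)%Z by rewrite /r gez0_abs // modz_ge0.
have rd : (r < d)%N by rewrite -ltz_nat rE ltz_pmod.
have /andP[tl tu] := truncn_itv y0.
set t := Num.truncn y in tl tu *.
(* [Y] is the number of naturals below [y]: it is [t] if [y] is an integer and [t + 1] otherwise. *)
pose Y := (t + (t%:R < y)%R)%N.
have ltY m : (m%:R < y) = (m < Y)%N.
  rewrite /Y; case: (ltP t%:R y) => [ty|yt].
    rewrite addn1 ltnS; apply/idP/idP => [my|mt].
      by rewrite -ltnS -(ltr_nat R) (lt_trans my).
    by apply: le_lt_trans ty; rewrite ler_nat.
  have -> : y = t%:R by apply/eqP; rewrite eq_le yt tl.
  by rewrite addn0 ltr_nat.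
have Yy : Y%:R < y + 1.
  rewrite /Y; case: (ltP t%:R y) => [ty|yt]; first by rewrite natrD ltrD2r.
  by rewrite addn0; lra.
have yY : y <= Y%:R.
  by rewrite leNgt ltY ltnn.
exists ((Y + (d - 1 - r)) %/ d)%N, r; set c := ((Y + _) %/ d)%N.
have cd1 : (c * d <= Y + (d - 1 - r))%N by apply: leq_trunc_div.
have cd2 : (Y + (d - 1 - r) < c.+1 * d)%N by apply: ltn_ceil.
have d0' : 0 < d%:R :> R by rewrite ltr0n.
have cd : (c * d)%:R <= y + d%:R.
  have : (c * d + 1 <= Y + d)%N by lia.
  rewrite -(ler_nat R) (natrD _ (c * d)) (natrD _ Y); lra.
split=> //.
- rewrite /A cardsE -sum1_card big_mkcond natr_sum mulr_sumr /=.
  have tY : (Y <= t.+1)%N by rewrite /Y -addn1 leq_add2l; case: (_ < _).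
  pose f m : R := if (m < Y)%N && (m %% d == r)%N then 1 + thue_morse R m else 0.
  rewrite (eq_bigr (fun m : 'I__ => f m)); last first.
    move=> m _; rewrite -topredE /= ltY /f -rE modz_nat eqz_nat -double_even_indicator.
    by case: (m < Y)%N; case: (m %% d == r)%N; case: (binary_ones m == _ %[mod _])%N;
      rewrite /= ?mulr0.
  rewrite (big_ord_split f tY) [X in _ + X]big1 ?addr0 => [|m _]; last first.
    by rewrite /f ltnNge leq_addr.
  rewrite -[c%:R](_ : \sum_(n < c) 1 = _); last by rewrite sumr_const card_ord.
  rewrite /dilate_sum -big_split /= -(sum_residue_class (fun m => 1 + thue_morse R m) Y rd).
  by rewrite [RHS]big_mkcond; apply: eq_bigr => m _; rewrite /f ltn_ord.
- rewrite ler_norml; apply/andP; split.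
    rewrite -(ler_pM2r d0') mulrBl divfK ?lt0r_neq0 // -natrM.
    have : (Y <= c * d + d)%N by rewrite mulSn in cd2; lia.
    rewrite -(ler_nat R) (natrD _ (c * d)); lra.
  rewrite -(ler_pM2r d0') mulrBl divfK ?lt0r_neq0 // -natrM; lra.
Qed.

(** Twice the signed discrepancy is [c - y / d], at most 1 in absolute value, plus a Thue-Morse sum
    along the progression, at most [b]. *)
Lemma discrepancy_le (x y b : R) X d (j : int) : x <= X%:R -> 0 <= y <= x -> (0 < d)%N ->
  progression_bound X d b -> discrepancy y d j <= 1 + b.
Proof.
move=> xX /andP[y0 yx] d0 hb; have [c [r [e1 e2 e3]]] := double_A j y0 d0.
have cX : (c * d <= X + d)%N.
  rewrite -(ler_nat R) natrD (le_trans e3) // lerD2r; lra.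
have h := hb c r cX.
have d0' : d%:R != 0 :> R by rewrite pnatr_eq0 -lt0n.
have -> : discrepancy y d j = `|(c%:R - y / d%:R + dilate_sum R c d r) / 2|.
  by rewrite /discrepancy; congr `| _ |; rewrite addrAC -e1; field.
rewrite normrM (ger0_norm (_ : 0 <= 2^-1)) ?invr_ge0 //; have := ler_normD (c%:R - y / d%:R) (dilate_sum R c d r).
have := normr_ge0 (dilate_sum R c d r); lra.
Qed.

Lemma max_discrepancy_le (x b : R) X d : x <= X%:R -> (0 < d)%N ->
  progression_bound X d b -> (max_discrepancy x d <= (1 + b)%:E)%E.
Proof.
move=> xX d0 hb; apply: ge_ereal_sup => _ [y yx <-]; apply: ge_ereal_sup => _ [j _ <-].
by rewrite lee_fin (discrepancy_le _ xX).
Qed.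

End Bridge.

(** * Choice of the dyadic scale and of the exponent *)

Theorem corollary2p2 (R : realType) (delta : R)
    (hdelta : 0 < delta < 2 / 3) :
  exists eta C : R, 0 < eta /\
    forall x : R, 1 <= x ->
      (\sum_(1 <= d < (Num.truncn (x `^ delta)).+1) max_discrepancy x d
         <= (C * x `^ (1 - eta))%:E)%E.
Proof.
have /andP[delta0 delta1] := hdelta.
(* The room between [delta] and 2/3 is at least [1 / w]. *)
have [w w8 hw] : exists2 w, (8 <= w)%N & delta <= 2 / 3 - w%:R^-1.
  have h : 0 < (2 / 3 - delta)^-1 by rewrite invr_gt0; lra.
  exists (Num.truncn (2 / 3 - delta)^-1 + 8)%N; first exact: leq_addl.
  have := truncnS_gt (2 / 3 - delta)^-1.
  set T := Num.truncn _ => hT.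
  have h2 : (2 / 3 - delta)^-1 <= (T + 8)%:R.
    by apply: le_trans (ltW hT) _; rewrite ler_nat; lia.
  have := lef_pV2 (x := (T + 8)%:R) (y := (2 / 3 - delta)^-1).
  rewrite !posrE ltr0n addn_gt0 orbT h => /(_ isT isT); rewrite h2 invrK; lra.
have [M [C [M0 C0 main]]] := progression_bounds_sum R w8.
have w0 : (0 < w)%N by apply: leq_trans w8.
(* One factor 2 comes from [2 ^ L <= 2 x], the other from rounding down [L / M]. *)
exists M%:R^-1, (4 * C); split; first by rewrite invr_gt0 ltr0n.
move=> x x1; have x0 : 0 < x by lra.
have [L xL Lx] : exists2 L : nat, x <= 2 ^+ L & 2 ^+ L <= 2 * x.
  have t1 : (0 < Num.truncn x)%N by rewrite truncn_gt0.
  have := @up_log_bounds 2 (Num.truncn x).+1 isT; rewrite ltnS => /(_ t1) /andP[lo hi].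
  exists (up_log 2 (Num.truncn x).+1).
    by apply: le_trans (ltW (truncnS_gt x)) _; rewrite -natrX ler_nat.
  have : (0 < up_log 2 (Num.truncn x).+1)%N by rewrite up_log_gt0.
  move: lo; case: (up_log _ _) => // l /=; rewrite ltnS => lo _.
  rewrite exprS ler_wpM2l // -natrX (le_trans (_ : _ <= (Num.truncn x)%:R)) ?ler_nat //.
  by rewrite truncn_le // ltW.
(* [2 ^ K] exceeds [(2 ^ L) ^ delta], hence [x ^ delta], so all moduli lie below it. *)
set K := (Num.truncn (delta * L%:R)).+1.
have dL : 0 <= delta * L%:R by rewrite mulr_ge0 // ltW.
have KL : (3 * K + 3 * (L %/ w) <= 2 * L + 3)%N.
  have h1 : (Num.truncn (delta * L%:R))%:R <= delta * L%:R by rewrite truncn_le.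
  have h2 : (L %/ w)%:R <= L%:R / w%:R :> R.
    by rewrite ler_pdivlMr ?ltr0n // -natrM ler_nat leq_trunc_div.
  have h3 : delta * L%:R <= (2 / 3 - w%:R^-1) * L%:R by rewrite ler_wpM2r.
  rewrite /K -(ler_nat R) !natrD !natrM -natr1; lra.
have [F [F0 hF sF]] := main L K KL.
have DK : (Num.truncn (x `^ delta) < 2 ^ K)%N.
  rewrite -(ltr_nat R) natrX; apply: (@le_lt_trans _ _ (x `^ delta)).
    by rewrite truncn_le // powR_ge0.
  apply: (@le_lt_trans _ _ ((2 ^+ L) `^ delta)).
    by rewrite ge0_ler_powR ?nnegrE ?exprn_ge0 // ltW.
  rewrite -!powR_mulrn // -powRrM /powR pnatr_eq0 /= ltr_expR ltr_pM2r; last first.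
    by rewrite ln_gt0 // ltr1n.
  by rewrite mulrC; apply: truncnS_gt.
apply: (@le_trans _ _ (\sum_(1 <= d < (Num.truncn (x `^ delta)).+1) (1 + F d)%:E)%E).
  rewrite big_nat_cond [leRHS]big_nat_cond; apply: lee_sum => d.
  rewrite andbT ltnS => /andP[d0 dD].
  apply: (@max_discrepancy_le R x (F d) (2 ^ L) d) => //; first by rewrite natrX.
  by apply: hF; rewrite d0 (leq_ltn_trans dD).
rewrite sumEFin lee_fin.
apply: (@le_trans _ _ (C * (2 ^+ L / 2 ^+ (L %/ M)))).
  apply: le_trans sF.
  apply: (@le_trans _ _ (\sum_(0 <= d < (Num.truncn (x `^ delta)).+1) (1 + F d))).
    rewrite [leRHS]big_nat_recl // big_add1 /=.
    by rewrite lerDr addr_ge0.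
  rewrite big_mkord; apply: (@ler_sum_ord_widen R _ _ (fun d => 1 + F d)) => // d.
  exact: addr_ge0.
rewrite [4 * C]mulrC -mulrA ler_wpM2l //.
set s := (L %/ M)%N.
have hs : x `^ M%:R^-1 <= 2 ^+ s.+1.
  have -> : (2 : R) ^+ s.+1 = (2 ^+ (s.+1 * M)) `^ M%:R^-1.
    by rewrite -!powR_mulrn ?exprn_ge0 // -powRrM natrM mulfK // pnatr_eq0 -lt0n.
  rewrite ge0_ler_powR ?nnegrE ?invr_ge0 ?exprn_ge0 ?(ltW x0) //.
  apply: le_trans xL _; rewrite ler_weXn2l ?ler1n //.
  by apply: ltnW; apply: ltn_ceil.
have p0 : 0 < x `^ M%:R^-1 by rewrite powR_gt0.
rewrite powRB // ?powRr1 ?(ltW x0) //; last by rewrite (gt_eqF x0) implybT.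
rewrite ler_pdivrMr ?exprn_gt0 //.
have -> : 4 * (x / x `^ M%:R^-1) * 2 ^+ s = 2 * x * (2 ^+ s.+1 / x `^ M%:R^-1).
  by rewrite exprS; field; rewrite lt0r_neq0.
apply: le_trans Lx _; rewrite ler_peMr ?mulr_ge0 ?(ltW x0) //.
by rewrite ler_pdivlMr // mul1r.
Qed.
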